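(* Let $F:\mathbb R^d\to\mathbb R$ be bounded below by $F^*$, $L$-smooth and twice differentiable, with stochastic gradients satisfying the $p$-bounded central moment condition with constant $\sigma$ and stochastic Hessians satisfying the $p$-bounded central moment condition with constant $\sigma_h$, where $p\in(1,2]$. Let $\Delta=F(x_0)-F^*$ and let $\varepsilon>0$. Let the initial gradient estimate be $$g_0=\frac1{B_{\mathrm{init}}}\sum_{j=1}^{B_{\mathrm{init}}}\nabla f(x_0,\xi_{0,j}),\qquad B_{\mathrm{init}}=\max\Big\{1,\Big(\frac\sigma\varepsilon\Big)^{\frac p{p-1}},\Big(\frac\sigma\varepsilon\Big)^{\frac p{2p-1}}\Big\}$$ (rounded up to an integer), with $\xi_{0,j}\sim\mathcal D$ i.i.d. Set the stepsize $\gamma=\sqrt{\frac{\Delta\alpha^{1/p}}{(L+\sigma_h)T}}$ and the momentum parameter $\alpha=\min\{1,\alpha_{\mathrm{eff}}\}$, where $$\alpha_{\mathrm{eff}}=\max\Big\{\Big(\frac{\mathcal E_0}{T\sigma}\Big)^{\frac p{2p-1}},\Big(\frac{\Delta(L+\sigma_h)}{T\sigma^2}\Big)^{\frac p{2p-1}}\Big\},\qquad \mathcal E_0=\frac{2\sigma}{B_{\mathrm{init}}^{(p-1)/p}}.$$ Then the algorithm NSGDHess, run with these parameters for a suitable number of iterations $T$, guarantees $$\frac1T\sum_{t=0}^{T-1}\mathbb E\big[\|\nabla F(x_t)\|\big]\le\varepsilon$$ with total sample complexity $$\mathcal O\Big(\frac{\Delta(L+\sigma_h)}{\varepsilon^2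}+\frac{\Delta(L+\sigma_h)}{\varepsilon^2}\Big(\frac\sigma\varepsilon\Big)^{\frac1{p-1}}+\frac\sigma\varepsilon\Big(\frac\sigma\varepsilon\Big)^{\frac1{p-1}}\Big).$$
   Context: **Problem.** Minimize $F(x)=\mathbb E_{\xi\sim\mathcal D}[f(x,\xi)]$ over $x\in\mathbb R^d$. **Assumptions.** (Lower boundedness) $F\ge F^*>-\infty$. ($L$-smoothness) $F$ is differentiable and $\|\nabla F(x)-\nabla F(y)\|\le L\|x-y\|$ for all $x,y$. ($p$-BCM for gradients) stochastic gradients $\nabla f(x,\xi)$ are available with $\mathbb E[\nabla f(x,\xi)]=\nabla F(x)$ and $\mathbb E[\|\nabla f(x,\xi)-\nabla F(x)\|^p]\le\sigma^p$ for all $x$, $\sigma>0$. ($p$-BCM for Hessians) $F$ is twice differentiable and stochastic Hessian-vector products $\nabla^2f(x,\xi)\cdot v$ are available for every $v\in\mathbb R^d$, with $\mathbb E[\nabla^2f(x,\xi)]=\nabla^2F(x)$ and $\mathbb E[\|\nabla^2f(x,\xi)-\nabla^2F(x)\|_{\mathrm{op}}^p]\le\sigma_h^p$ for all $x$, $\sigma_h>0$. **Algorithm NSGDHess.** Input: $x_0\in\mathbb R^d$, $g_0\in\mathbb R^d$, stepsize $\gamma>0$, momentum parameter $\alpha>0$, number of iterations $T$. Set $x_1=x_0-\gamma\,g_0/\|g_0\|$. For $t=1,\dots,T-1$: sample $q_t$ uniformly on $[0,1]$; set $\hat x_t=q_tx_t+(1-q_t)x_{t-1}$; sample $\xi_t,\hat\xi_t\sim\mathcal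 D$ independently (all samples $q_t,\xi_t,\hat\xi_t$ are independent of each other and of the past); set $$g_t=(1-\alpha)\big(g_{t-1}+\nabla^2f(\hat x_t,\hat\xi_t)(x_t-x_{t-1})\big)+\alpha\nabla f(x_t,\xi_t),\qquad x_{t+1}=x_t-\gamma\frac{g_t}{\|g_t\|}.$$ The convention $g/\|g\|=0$ for $g=0$ is used. **Total sample complexity** is the total number of stochastic gradient and stochastic Hessian-vector evaluations, including the $B_{\mathrm{init}}$ evaluations for $g_0$. $\mathcal O(\cdot)$ records the dominating terms for small $\varepsilon$; the hidden multiplicative constant depends at most on $p$. *)

(* Defs.v *)
From HB Require Import structures.
From mathcomp Require Import all_boot all_order all_algebra.
From mathcomp Require Import all_classical all_reals all_analysis.

Set Implicit Arguments.
Unset Strict Implicit.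
Unset Printing Implicit Defensive.

Import Order.TTheory GRing.Theory Num.Theory.
Import numFieldNormedType.Exports.

Local Open Scope classical_set_scope.
Local Open Scope ring_scope.

(* Points of R^d are row vectors, and matrices act on them on the right, as
   the library's Jacobian does: 'D_v g x = v *m 'J g x.  The norm that MathComp
   puts on 'rV[R]_d is the sup norm; it gives the same derivatives as the
   Euclidean norm, but the Euclidean norm itself has to be defined. *)

Definition enorm (R : realType) (d : nat) (v : 'rV[R]_d) : R :=
  Num.sqrt (\sum_(i < d) v 0 i ^+ 2).

Definition opnorm (R : realType) (d : nat) (A : 'M[R]_d) : R :=
  sup [set enorm (v *m A) | v in [set v : 'rV[R]_d | enorm v <= 1]].

(* g / ||g||; it is 0 for g = 0, because 0^-1 = 0 and 0 *: 0 = 0. *)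
Definition normalize (R : realType) (d : nat) (g : 'rV[R]_d) : 'rV[R]_d :=
  (enorm g)^-1 *: g.

Definition grad (R : realType) (d : nat) (F : 'rV[R]_d -> R) (x : 'rV[R]_d) :
    'rV[R]_d :=
  \row_(i < d) 'D_(delta_mx 0 i) F x.

Definition hessian (R : realType) (d : nat) (F : 'rV[R]_d -> R)
    (x : 'rV[R]_d) : 'M[R]_d :=
  'J (grad F) x.

Definition smooth (R : realType) (d : nat) (L : R) (F : 'rV[R]_d -> R) : Prop :=
  (forall x, differentiable F x) /\
  (forall x y, enorm (grad F x - grad F y) <= L * enorm (x - y)).

Definition twice_differentiable (R : realType) (d : nat)
    (F : 'rV[R]_d -> R) : Prop :=
  (forall x, differentiable F x) /\ (forall x, differentiable (grad F) x).

(* Stochastic gradients gf x xi and stochastic Hessians Hf x xi are oracles: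
   besides the moment conditions, they are only required to be jointly
   measurable in (x, xi).  Joint measurability is expressed through the
   library's sigma-algebra on d.-tuple R, the Borel sigma-algebra of R^d. *)

Definition vec_of_tuple (R : realType) (d : nat) (u : d.-tuple R) : 'rV[R]_d :=
  \row_(i < d) tnth u i.

Definition jointly_measurable (R : realType) (d : nat) (dX : measure_display)
    (Xi : measurableType dX) (h : 'rV[R]_d -> Xi -> R) : Prop :=
  measurable_fun [set: (d.-tuple R * Xi)%type]
    (fun y : d.-tuple R * Xi => h (vec_of_tuple y.1) y.2).

(* Since p > 1, the moment bound and measurability make the entries of the
   oracles integrable, so the expectations are genuine ones. *)

Definition grad_pBCM (R : realType) (d : nat) (dX : measure_display)
    (Xi : measurableType dX) (D : probability Xi R) (p sigma : R)
    (F : 'rV[R]_d -> R) (gf : 'rV[R]_d -> Xi -> 'rV[R]_d) : Prop :=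
  (forall i, jointly_measurable (fun x xi => gf x xi ord0 i)) /\
  (forall x,
    (forall i, ('E_D[fun xi => gf x xi ord0 i] = (grad F x ord0 i)%:E)%E) /\
    ('E_D[fun xi => (enorm (gf x xi - grad F x) `^ p)%R] <= (sigma `^ p)%:E)%E).

Definition hess_pBCM (R : realType) (d : nat) (dX : measure_display)
    (Xi : measurableType dX) (D : probability Xi R) (p sigma_h : R)
    (F : 'rV[R]_d -> R) (Hf : 'rV[R]_d -> Xi -> 'M[R]_d) : Prop :=
  (forall i j, jointly_measurable (fun x xi => Hf x xi i j)) /\
  (forall x,
    (forall i j, ('E_D[fun xi => Hf x xi i j] = (hessian F x i j)%:E)%E) /\
    ('E_D[fun xi => (opnorm (Hf x xi - hessian F x) `^ p)%R]
       <= (sigma_h `^ p)%:E)%E).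

(* The random inputs: the points xi_{0,j} of the initial batch, and q_t, xi_t
   and \hat xi_t at iteration t. *)
Variant sample : Type :=
  | InitSample of nat
  | UnifSample of nat
  | GradSample of nat
  | HessSample of nat.

HB.instance Definition _ := gen_eqMixin sample.

(* The product rule for every finite subfamily of a family of classes of
   events. *)
Definition mutually_independent (R : realType) (dO : measure_display)
    (Omega : measurableType dO) (P : probability Omega R) (I : eqType)
    (G : I -> set (set Omega)) : Prop :=
  forall (s : seq I) (A : I -> set Omega), uniq s ->
    (forall i, i \in s -> G i (A i)) ->
    P (\bigcap_(i in [set` s]) A i) = \big[*%E/1%E]_(i <- s) P (A i).

Definition has_law (R : realType) (dO dE : measure_display)
    (Omega : measurableType dO) (E : measurableType dE)
    (P : probability Omega R) (X : {RV P >-> E}) (Q : set E -> \bar R) : Prop :=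
  forall A, measurable A -> distribution P X A = Q A.

Definition sample_sigma (R : realType) (dO dX : measure_display)
    (Omega : measurableType dO) (Xi : measurableType dX)
    (P : probability Omega R) (xi0 xi xih : nat -> {RV P >-> Xi})
    (q : nat -> {RV P >-> R}) (s : sample) : set (set Omega) :=
  match s with
  | InitSample j => preimage_set_system setT (xi0 j) measurable
  | UnifSample t => preimage_set_system setT (q t) measurable
  | GradSample t => preimage_set_system setT (xi t) measurable
  | HessSample t => preimage_set_system setT (xih t) measurable
  end.

Definition valid_sampling (R : realType) (dO dX : measure_display)
    (Omega : measurableType dO) (Xi : measurableType dX)
    (P : probability Omega R) (D : probability Xi R)
    (xi0 xi xih : nat -> {RV P >-> Xi}) (q : nat -> {RV P >-> R}) : Prop :=
  [/\ forall t, [/\ has_law (xi0 t) D, has_law (xi t) D & has_law (xih t) D],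
      forall t, has_law (q t) (uniform_prob (@ltr01 R)) &
      mutually_independent P (sample_sigma xi0 xi xih q)].

(* The triple (x_t, x_{t+1}, g_t), for given realizations of the samples. *)
Fixpoint nsgdhess (R : realType) (d : nat) (X : Type)
    (gf : 'rV[R]_d -> X -> 'rV[R]_d) (Hf : 'rV[R]_d -> X -> 'M[R]_d)
    (gamma alpha : R) (x0 g0 : 'rV[R]_d) (q : nat -> R) (xi xih : nat -> X)
    (t : nat) : 'rV[R]_d * 'rV[R]_d * 'rV[R]_d :=
  match t with
  | 0%N => (x0, x0 - gamma *: normalize g0, g0)
  | t'.+1 =>
      let: (xprev, x, gprev) :=
        nsgdhess gf Hf gamma alpha x0 g0 q xi xih t' in
      let xhat := q t *: x + (1 - q t) *: xprev in
      let g := (1 - alpha) *: (gprev + (x - xprev) *m Hf xhat (xih t))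
               + alpha *: gf x (xi t) in
      (x, x - gamma *: normalize g, g)
  end.

Definition nsgdhess_x (R : realType) (d : nat) (X : Type)
    (gf : 'rV[R]_d -> X -> 'rV[R]_d) (Hf : 'rV[R]_d -> X -> 'M[R]_d)
    (gamma alpha : R) (x0 g0 : 'rV[R]_d) (q : nat -> R) (xi xih : nat -> X)
    (t : nat) : 'rV[R]_d :=
  (nsgdhess gf Hf gamma alpha x0 g0 q xi xih t).1.1.

Definition batch_mean (R : realType) (d : nat) (X : Type)
    (gf : 'rV[R]_d -> X -> 'rV[R]_d) (x0 : 'rV[R]_d) (B : nat)
    (xi0 : nat -> X) : 'rV[R]_d :=
  B%:R^-1 *: \sum_(j < B) gf x0 (xi0 j).

Definition B_init (R : realType) (p sigma eps : R) : nat :=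
  absz (Num.ceil (Num.max 1 (Num.max ((sigma / eps) `^ (p / (p - 1)))
                                     ((sigma / eps) `^ (p / (2 * p - 1)))))).

Definition E_init (R : realType) (p sigma : R) (B : nat) : R :=
  2 * sigma / (B%:R `^ ((p - 1) / p)).

Definition alpha_eff (R : realType) (p L sigma sigma_h Delta : R) (B T : nat) :
    R :=
  Num.max ((E_init p sigma B / (T%:R * sigma)) `^ (p / (2 * p - 1)))
          ((Delta * (L + sigma_h) / (T%:R * sigma ^+ 2)) `^ (p / (2 * p - 1))).

Definition momentum (R : realType) (p L sigma sigma_h Delta : R) (B T : nat) :
    R :=
  Num.min 1 (alpha_eff p L sigma sigma_h Delta B T).

Definition stepsize (R : realType) (p L sigma_h Delta alpha : R) (T : nat) : R :=
  Num.sqrt (Delta * alpha `^ (p^-1) / ((L + sigma_h) * T%:R)).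

(* B stochastic gradients for g_0, then one stochastic gradient and one
   stochastic Hessian-vector product at each of the iterations 1, ..., T-1. *)
Definition sample_complexity (B T : nat) : nat := (B + 2 * (T - 1))%N.

(* Main.v *)
(* With e_t = g_t - grad F(x_t), descent along the normalized direction gives,
   pathwise, gamma sum_t |grad F(x_t)| <= Delta + 2 gamma sum_t |e_t| + T L gamma^2 / 2.
   The error satisfies e_{t+1} = (1 - alpha) e_t + (three noises), one for each of
   q, \hat xi and xi, and each of them is centered once the earlier ones are frozen;
   for q this is the fundamental theorem of calculus along the segment from x_t to
   x_{t+1}.  Since |a + b|^p <= |a|^p + p |a|^(p-2) <a, b> + 6 |b|^p for 1 < p <= 2,
   a centered noise adds at most six times its p-th moment to E|a|^p.  Hence
   E|e_{t+1}|^p <= (1 - alpha)^p E|e_t|^p + V, and the same inequality applied to the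
   partial sums of the initial batch bounds E|e_0|^p.  Conditional expectations are
   avoided: the iterates form a Markov chain driven by fresh independent samples, so
   only the joint law of the current state and the next sample is needed. *)
Require Import Defs.
From HB Require Import structures.
From mathcomp Require Import all_boot all_order all_algebra.
From mathcomp Require Import all_classical all_reals all_analysis.
From mathcomp Require Import measurable_realfun ring lra.

Set Implicit Arguments.
Unset Strict Implicit.
Unset Printing Implicit Defensive.

Import Order.TTheory GRing.Theory Num.Theory.
Import numFieldNormedType.Exports.

Local Open Scope classical_set_scope.
Local Open Scope ring_scope.

(** * Euclidean norm *)

(** For p < 2 the second moments may be infinite, so errors are followed in p-th moment and reach
    the mean only at the end, through x <= c^(1-p) x^p + c, which costs a factor 2 and extracts no
    p-th root. The Hessian may be discontinuous, so the integral along a segment is controlled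
    through the Lipschitz gradient, whose difference quotients are uniformly bounded. In one step
    the noise has size about gamma (L + sigma_h) + alpha sigma; summing the recursion divides it by
    alpha^(1/p). Balancing gamma (L + sigma_h) / alpha^(1/p) against Delta / (gamma T) gives the
    stepsize; balancing alpha^(1-1/p) sigma against E_0 / (alpha T), and against the optimized
    stepsize terms, gives the two ratios in [alpha_eff]. All terms are then multiples of one
    quantity, and T is taken large enough to bring their sum below eps. The case Delta = 0 is
    treated apart, since the stepsize then vanishes. *)

Definition edot {R : realType} {d : nat} (u v : 'rV[R]_d) : R :=
  \sum_(i < d) u 0 i * v 0 i.

Lemma edotC (R : realType) d (u v : 'rV[R]_d) : edot u v = edot v u.
Proof. by apply: eq_bigr => i _; rewrite mulrC. Qed.

Lemma edotDl (R : realType) d (u v w : 'rV[R]_d) :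
  edot (u + v) w = edot u w + edot v w.
Proof. by rewrite -big_split; apply: eq_bigr => i _; rewrite !mxE mulrDl. Qed.

Lemma edotZl (R : realType) d a (u v : 'rV[R]_d) :
  edot (a *: u) v = a * edot u v.
Proof. by rewrite mulr_sumr; apply: eq_bigr => i _; rewrite !mxE mulrA. Qed.

Lemma edotNl (R : realType) d (u v : 'rV[R]_d) : edot (- u) v = - edot u v.
Proof. by rewrite -scaleN1r edotZl mulN1r. Qed.

Lemma edotDr (R : realType) d (u v w : 'rV[R]_d) :
  edot w (u + v) = edot w u + edot w v.
Proof. by rewrite edotC edotDl !(edotC w). Qed.

Lemma edotZr (R : realType) d a (u v : 'rV[R]_d) :
  edot u (a *: v) = a * edot u v.
Proof. by rewrite edotC edotZl edotC. Qed.

Lemma edotNr (R : realType) d (u v : 'rV[R]_d) : edot u (- v) = - edot u v.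
Proof. by rewrite edotC edotNl edotC. Qed.

Lemma edot_ge0 (R : realType) d (u : 'rV[R]_d) : 0 <= edot u u.
Proof. by apply: sumr_ge0 => i _; rewrite -expr2 sqr_ge0. Qed.

Lemma enorm_ge0 (R : realType) d (u : 'rV[R]_d) : 0 <= enorm u.
Proof. exact: sqrtr_ge0. Qed.

Lemma sqr_enorm (R : realType) d (u : 'rV[R]_d) : enorm u ^+ 2 = edot u u.
Proof.
rewrite /enorm sqr_sqrtr; first by apply: eq_bigr => i _; rewrite expr2.
by apply: sumr_ge0 => i _; rewrite sqr_ge0.
Qed.

Lemma coord_le_enorm (R : realType) d (u : 'rV[R]_d) i : `|u 0 i| <= enorm u.
Proof.
rewrite -(@ler_pXn2r _ 2) ?nnegrE ?enorm_ge0// sqr_enorm -normrX ger0_norm ?sqr_ge0//.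
rewrite /edot (bigD1 i)//= expr2 lerDl; apply: sumr_ge0 => j _.
by rewrite -expr2 sqr_ge0.
Qed.

Lemma enorm_eq0 (R : realType) d (u : 'rV[R]_d) : enorm u = 0 -> u = 0.
Proof.
move=> u0; apply/rowP => i; rewrite mxE; apply/normr0_eq0/le_anti.
by rewrite normr_ge0 andbT -u0 coord_le_enorm.
Qed.

Lemma enorm0 (R : realType) d : enorm (0 : 'rV[R]_d) = 0.
Proof.
by apply/eqP; rewrite -sqrf_eq0 sqr_enorm /edot big1// => i _; rewrite !mxE mul0r.
Qed.

Lemma enormZ (R : realType) d a (u : 'rV[R]_d) : enorm (a *: u) = `|a| * enorm u.
Proof.
apply/eqP; rewrite -(@eqrXn2 _ 2) ?mulr_ge0 ?enorm_ge0//; apply/eqP.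
by rewrite exprMn !sqr_enorm edotZl edotZr mulrA -expr2 -normrX ger0_norm ?sqr_ge0.
Qed.

Lemma enormN (R : realType) d (u : 'rV[R]_d) : enorm (- u) = enorm u.
Proof. by rewrite -scaleN1r enormZ normrN1 mul1r. Qed.

Lemma edot_le (R : realType) d (u v : 'rV[R]_d) : edot u v <= enorm u * enorm v.
Proof.
have [u0|u0] := eqVneq (enorm u) 0.
  by rewrite u0 mul0r (enorm_eq0 u0) /edot big1// => i _; rewrite mxE mul0r.
have [v0|v0] := eqVneq (enorm v) 0.
  by rewrite v0 mulr0 (enorm_eq0 v0) /edot big1// => i _; rewrite mxE mulr0.
have a0 : 0 < enorm u by rewrite lt_neqAle eq_sym u0 enorm_ge0.
have b0 : 0 < enorm v by rewrite lt_neqAle eq_sym v0 enorm_ge0.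
have := edot_ge0 (enorm v *: u - enorm u *: v).
rewrite !(edotDl, edotDr, edotNl, edotNr, edotZl, edotZr) (edotC v u) -!sqr_enorm.
set a := enorm u in a0 *; set b := enorm v in b0 *; move=> h.
rewrite -(ler_pM2l (mulr_gt0 a0 b0)) -subr_ge0; lra.
Qed.

Lemma sqr_enormD (R : realType) d (u v : 'rV[R]_d) :
  enorm (u + v) ^+ 2 = enorm u ^+ 2 + 2 * edot u v + enorm v ^+ 2.
Proof. by rewrite !sqr_enorm !(edotDl, edotDr) (edotC v u); ring. Qed.

Lemma enormD (R : realType) d (u v : 'rV[R]_d) :
  enorm (u + v) <= enorm u + enorm v.
Proof.
rewrite -(@ler_pXn2r _ 2) ?nnegrE ?addr_ge0 ?enorm_ge0// sqr_enormD.
by have := edot_le u v; nra.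
Qed.

Lemma enormB (R : realType) d (u v : 'rV[R]_d) :
  enorm (u - v) <= enorm u + enorm v.
Proof. by rewrite -[enorm v]enormN; exact: enormD. Qed.

Lemma enorm_normalize_le1 (R : realType) d (g : 'rV[R]_d) : enorm (normalize g) <= 1.
Proof.
rewrite /normalize enormZ normfV ger0_norm ?enorm_ge0//.
by have [->|g0] := eqVneq (enorm g) 0; rewrite ?mulr0// mulVf.
Qed.

Lemma edot_normalize (R : realType) d (g : 'rV[R]_d) : edot g (normalize g) = enorm g.
Proof.
rewrite /normalize edotZr -sqr_enorm.
have [->|g0] := eqVneq (enorm g) 0; first by rewrite expr0n mulr0.
by rewrite expr2 mulrA mulVf// mul1r.
Qed.

Lemma enorm_delta_mx (R : realType) d (i : 'I_d) :
  enorm (delta_mx 0 i : 'rV[R]_d) = 1.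
Proof.
apply/eqP; rewrite -(@eqrXn2 _ 2) ?enorm_ge0// sqr_enorm expr1n /edot (bigD1 i)//=.
rewrite big1 ?addr0 ?mxE ?eqxx ?mulr1// => j ji.
by rewrite !mxE (negbTE ji) mul0r.
Qed.

Lemma enorm_le_sum (R : realType) d (u : 'rV[R]_d) :
  enorm u <= \sum_(i < d) `|u 0 i|.
Proof.
rewrite {1}(_ : u = \sum_(i < d) u 0 i *: delta_mx 0 i); last exact: row_sum_delta.
elim/big_ind2 : _ => [|x1 x2 y1 y2 h1 h2|i _].
- by rewrite enorm0.
- by rewrite (le_trans (enormD _ _))// lerD.
- by rewrite enormZ enorm_delta_mx mulr1.
Qed.

(** The right side is the tangent at 1 of a concave power. The inequality is Young's for the product
    of x^s and 1 with exponents 1/s and 1/(1-s), which is why s = 1 is split off. *)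
Lemma powR_le_affine (R : realType) (x s : R) : 0 <= x -> 0 < s <= 1 ->
  x `^ s <= 1 + s * (x - 1).
Proof.
move=> x0 /andP[s0]; rewrite le_eqVlt => /predU1P[->|s1].
  by rewrite powRr1// mul1r addrC subrK.
have := @conjugate_powR R (x `^ s) 1 s^-1 (1 - s)^-1 (powR_ge0 _ _) ler01.
rewrite !invr_gt0 s0 subr_gt0 s1 !invrK subrKC -powRrM mulfV ?gt_eqF// powRr1//.
by rewrite powR1 mulr1 => /(_ isT isT erefl) /le_trans; apply; lra.
Qed.

(** Writing z^p = z z^(p-1) reduces this to monotonicity of z^(p-1). It lets a sum of p-th powers be
    bounded by the p-th power of a sum, so that no root is ever taken. *)
Lemma powR_superadd (R : realType) (x y p : R) : 0 <= x -> 0 <= y -> 1 <= p ->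
  x `^ p + y `^ p <= (x + y) `^ p.
Proof.
move=> x0 y0 p1; have p0 : p != 0 by rewrite gt_eqF// (lt_le_trans ltr01).
have E z : 0 <= z -> z `^ p = z * z `^ (p - 1).
  move=> z0; have [->|z1] := eqVneq z 0; first by rewrite powR0// mul0r.
  by rewrite -{2}(powRr1 z0) -powRD ?subrKC// z1 implybT.
rewrite !E ?addr_ge0// mulrDl lerD// ler_wpM2l//.
all: by rewrite ge0_ler_powR ?nnegrE ?subr_ge0 ?addr_ge0// (lerDl, lerDr).
Qed.

(* Concavity of [s `^ (p / 2)] at [s = |a|^2] when |b| <= |a|; otherwise every
   term is dominated by |b|^p. *)
Lemma enormD_powR (R : realType) d (p : R) (a b : 'rV[R]_d) : 1 < p <= 2 ->
  enorm (a + b) `^ p <=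
    enorm a `^ p + p * enorm a `^ (p - 2) * edot a b + 6 * enorm b `^ p.
Proof.
move=> /andP[p1 p2].
have p0 : 0 < p by lra.
(* At a = 0 the factor |a|^(p-2) is a default value of [powR]; it is multiplied by [edot a b], which
   is 0. *)
have [a0|a0] := eqVneq (enorm a) 0.
  rewrite a0 (enorm_eq0 a0) add0r powR0 ?gt_eqF// add0r.
  rewrite /edot [X in _ * X]big1 ?mulr0 ?add0r; last first.
    by move=> i _; rewrite mxE mul0r.
  by rewrite ler_peMl ?powR_ge0//; lra.
have ra : 0 < enorm a by rewrite lt_neqAle eq_sym a0 enorm_ge0.
have powE z q : 0 < z -> z `^ (p - q) * z `^ q = z `^ p.
  by move=> z0; rewrite -powRD ?subrK// (gt_eqF z0) implybT.
have pow2 (z : R) : 0 <= z -> z `^ 2 = z ^+ 2 by move=> z0; rewrite -powR_mulrn.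
have [ba|ab] := leP (enorm b) (enorm a).
- pose x := (enorm (a + b) / enorm a) ^+ 2.
  have xE : x = 1 + (2 * edot a b + enorm b ^+ 2) / enorm a ^+ 2.
    by rewrite /x expr_div_n sqr_enormD; field.
  have := @powR_le_affine R x (p / 2) (sqr_ge0 _).
  rewrite divr_gt0//= ler_pdivrMr// mul1r p2 => /(_ isT).
  have -> : x `^ (p / 2) = enorm (a + b) `^ p / enorm a `^ p.
    rewrite /x -powR_mulrn ?divr_ge0 ?enorm_ge0// -powRrM [2%:R * _]mulrC divfK//.
    by rewrite powRM ?invr_ge0 ?enorm_ge0// -powR_inv1 ?enorm_ge0// -powRrM mulN1r powRN.
  rewrite ler_pdivrMr ?powR_gt0// => /le_trans; apply.
  rewrite xE -(powE _ 2 ra) (pow2 _ (ltW ra)).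
  have -> : (1 + p / 2 * (1 + (2 * edot a b + enorm b ^+ 2) / enorm a ^+ 2 - 1)) *
     (enorm a `^ (p - 2) * enorm a ^+ 2) = 
     enorm a `^ (p - 2) * enorm a ^+ 2 + p * enorm a `^ (p - 2) * edot a b + 
     p / 2 * (enorm a `^ (p - 2) * enorm b ^+ 2) by field.
  rewrite lerD2l.
  have [b0|b0] := eqVneq (enorm b) 0.
    by rewrite b0 expr0n/= !mulr0 mulr_ge0 ?powR_ge0.
  have rb : 0 < enorm b by rewrite lt_neqAle eq_sym b0 enorm_ge0.
  have h : enorm a `^ (p - 2) * enorm b ^+ 2 <= enorm b `^ p.
    rewrite -(powE _ 2 rb) (pow2 _ (ltW rb)) ler_wpM2r ?sqr_ge0//.
    have -> : p - 2 = - (2 - p) by ring.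
    rewrite !powRN lef_pV2 ?posrE ?powR_gt0// ge0_ler_powR ?nnegrE ?enorm_ge0//.
    by rewrite subr_ge0.
  apply: le_trans (_ : 6 * (enorm a `^ (p - 2) * enorm b ^+ 2) <= _).
    by rewrite ler_wpM2r ?mulr_ge0 ?powR_ge0 ?sqr_ge0//; lra.
  by rewrite ler_pM2l.
(* Origin of the 6: here |a + b| <= 2 |b| gives 2^p <= 4 times |b|^p, and the cross term is at least
   -p |a|^(p-1) |b| >= -2 |b|^p; 4 + 2 = 6. *)
- have rb : 0 < enorm b := lt_trans ra ab.
  have h1 : enorm (a + b) `^ p <= 4 * enorm b `^ p.
    apply: le_trans (_ : (2 * enorm b) `^ p <= _).
      rewrite ge0_ler_powR ?nnegrE ?mulr_ge0 ?enorm_ge0 ?(ltW p0)//.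
      by rewrite (le_trans (enormD _ _))//; lra.
    rewrite powRM ?enorm_ge0// ler_wpM2r ?powR_ge0//.
    have -> : (4 : R) = 2 `^ 2 by rewrite pow2//; ring.
    by rewrite ler_powR//; lra.
  have h2 : - (2 * enorm b `^ p) <= p * enorm a `^ (p - 2) * edot a b.
    rewrite lerNl -mulrN -edotNr.
    apply: le_trans (_ : p * enorm a `^ (p - 2) * (enorm a * enorm b) <= _).
      rewrite ler_wpM2l ?mulr_ge0 ?powR_ge0 ?(ltW p0)//.
      by rewrite -[enorm b]enormN edot_le.
    have -> : p * enorm a `^ (p - 2) * (enorm a * enorm b) =
       p * (enorm a `^ (p - 1) * enorm b).
      rewrite -!mulrA; congr (_ * _); rewrite mulrA; congr (_ * _).
      rewrite -{2}(powRr1 (ltW ra)) -powRD ?a0 ?implybT//.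
      by congr (_ `^ _); ring.
    rewrite ler_pM ?mulr_ge0 ?powR_ge0 ?enorm_ge0 ?(ltW p0)//.
    rewrite -(powE _ 1 rb) (powRr1 (ltW rb)) ler_wpM2r ?enorm_ge0//.
    by rewrite ge0_ler_powR ?nnegrE ?enorm_ge0 ?subr_ge0 ?(ltW p1) ?(ltW ab).
  have := powR_ge0 (enorm a) p.
  lra.
Qed.

(** * Independence of a state and the samples to come *)

Lemma bigcap_seqE (I : eqType) (T : Type) (s : seq I) (B : I -> set T) :
  \bigcap_(i in [set` s]) B i = \big[setI/setT]_(i <- s) B i.
Proof.
elim: s => [|i s ih]; first by rewrite big_nil set_nil bigcap_set0.
rewrite big_cons -ih; apply/seteqP; split=> [x Bx|x [Bi Bs] k /=].
  split; first by apply: Bx => /=; rewrite mem_head.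
  by move=> k /= ks; apply: Bx; rewrite /= inE ks orbT.
by rewrite inE => /predU1P[->//|]; exact: Bs.
Qed.

Definition mkRV {dO dE : measure_display} {Omega : measurableType dO}
  {E : measurableType dE} {R : realType} {P : probability Omega R}
  {f : Omega -> E} (mf : measurable_fun setT f) : {RV P >-> E} :=
  mfun_Sub (mem_set mf).

(** Rectangles are a pi-system generating the product sigma-algebra; since [m1] is finite, the
    constant sequence [setT] serves as the exhaustion. *)
Lemma measure_eq_rectangles (d1 d2 : measure_display) (T1 : measurableType d1)
    (T2 : measurableType d2) (R : realType)
    (m1 m2 : {measure set (T1 * T2) -> \bar R}) :
  (m1 setT < +oo)%E ->
  (forall A B, measurable A -> measurable B -> m1 (A `*` B) = m2 (A `*` B)) ->
  forall C, measurable C -> m1 C = m2 C.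
Proof.
move=> m1oo m12 C mC.
apply: (measure_unique
  [set A `*` B | A in (@measurable _ T1) & B in (@measurable _ T2)]
  (fun=> setT)) => //.
- exact: measurable_prod_measurableType.
- move=> _ _ [A mA [B mB <-]] [A' mA' [B' mB' <-]].
  rewrite -setXI; exists (A `&` A'); first exact: measurableI.
  by exists (B `&` B') => //; exact: measurableI.
- by move=> _; exists setT => //; exists setT => //; rewrite setXTT.
- by rewrite bigcup_const//; exists 0%N.
- by move=> _ [A mA [B mB <-]]; exact: m12.
Qed.

(** [J] is the set of samples that the state [Y] has not consumed. The product rule is demanded
    against whole finite families from [J], not one sample at a time, so that it survives when one
    of these samples is adjoined to [Y]. *)
Definition indep_of (R : realType) (dO dS : measure_display)
    (Omega : measurableType dO) (S : measurableType dS)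
    (P : probability Omega R) (I : eqType) (G : I -> set (set Omega))
    (J : set I) (Y : Omega -> S) : Prop :=
  measurable_fun setT Y /\
  forall A, measurable A -> forall (s : seq I) (B : I -> set Omega),
    uniq s -> (forall i, i \in s -> J i /\ G i (B i)) ->
    P (Y @^-1` A `&` \bigcap_(i in [set` s]) B i) =
    (P (Y @^-1` A) * \big[*%E/1%E]_(i <- s) P (B i))%E.

Section independence.
Context (R : realType) (dO dS dE : measure_display).
Context (Omega : measurableType dO) (S : measurableType dS) (E : measurableType dE).
Context (P : probability Omega R) (I : eqType) (G : I -> set (set Omega)).

Lemma indep_of_cst (J : set I) (y : S) : mutually_independent P G ->
  indep_of P G J (fun=> y).
Proof.
move=> Pind; split; first exact: measurable_cst.
move=> A mA s B us GB; rewrite preimage_cst; case: ifPn => _.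
  by rewrite setTI probability_setT mul1e Pind// => i /GB[].
by rewrite set0I measure0 mul0e.
Qed.

Lemma indep_of_sub (J J' : set I) (Y : Omega -> S) : J' `<=` J ->
  indep_of P G J Y -> indep_of P G J' Y.
Proof.
move=> JJ' [mY Yind]; split=> // A mA s B us GB; apply: Yind => // i /GB[/JJ'].
by [].
Qed.

Lemma indep_of_comp (J : set I) (Y : Omega -> S) (phi : S -> E) :
  measurable_fun setT phi -> indep_of P G J Y -> indep_of P G J (phi \o Y).
Proof.
move=> mphi [mY Yind]; split; first exact: measurableT_comp.
move=> A mA s B us GB; rewrite comp_preimage; apply: Yind => //.
by rewrite -[X in measurable X]setTI; exact: mphi.
Qed.

Lemma indep_of_prob (J : set I) (Y : Omega -> S) (j : I) (Z : {RV P >-> E}) A B :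
  indep_of P G J Y -> J j -> G j = preimage_set_system setT Z measurable ->
  measurable A -> measurable B ->
  P (Y @^-1` A `&` Z @^-1` B) = (P (Y @^-1` A) * P (Z @^-1` B))%E.
Proof.
move=> [_ Yind] Jj Gj mA mB.
have := Yind A mA [:: j] (fun=> Z @^-1` B) isT.
rewrite bigcap_seqE !big_seq1; apply => i.
by rewrite inE => /eqP ->; split => //; rewrite Gj; exists B; rewrite ?setTI.
Qed.

(** With N the intersection of the events B i frozen, the law of (Y, Z) restricted to N and the full
    law of (Y, Z) scaled by the product of the P (B i) are finite measures that agree on rectangles,
    hence everywhere. *)
Lemma indep_of_pair (J : set I) (Y : Omega -> S) (j : I) (Z : {RV P >-> E}) :
  (forall i, G i `<=` measurable) ->
  indep_of P G J Y -> J j -> G j = preimage_set_system setT Z measurable ->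
  indep_of P G (J `\ j) (fun w => (Y w, Z w)).
Proof.
move=> mG Yind Jj Gj; have [mY Yi] := Yind.
have mYZ : measurable_fun setT (fun w => (Y w, Z w)).
  exact: measurable_fun_pair.
split=> // C mC s B us GB.
rewrite bigcap_seqE; pose N := \big[setI/setT]_(i <- s) B i.
have mN : measurable N.
  by rewrite /N big_seq; apply: bigsetI_measurable => i /GB[_ /mG].
pose c := \big[*%E/1%E]_(i <- s) P (B i).
have cfin : c \is a fin_num.
  rewrite /c big_seq; apply: (big_ind (fun x => x \is a fin_num)) => //.
    by move=> *; rewrite fin_numM.
  by move=> i /GB[_ /mG mB]; exact: fin_num_measure.
have c0 : (0 <= fine c)%R.
  by apply: fine_ge0; apply: (big_ind (fun x => 0 <= x)%E) => // x y; exact: mule_ge0.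
pose X : {RV P >-> (S * E)%type} := mkRV mYZ.
pose m1' := [the {measure set (S * E)%type -> \bar R} of pushforward (mrestr P mN) X].
pose m1 := m1' mYZ.
pose m2 := [the {measure set (S * E)%type -> \bar R} of
  mscale (NngNum c0) (distribution P X)].
have : m1 C = m2 C.
  apply: measure_eq_rectangles => //.
    rewrite /m1 /m1' /= /pushforward /mrestr preimage_setT setTI.
    by rewrite (le_lt_trans (probability_le1 _ _)) ?ltry.
  move=> A A' mA mA'; rewrite /m1 /m1' /m2 /= /mscale /distribution /pushforward /mrestr/=.
  rewrite -[distribution P X _]/(P (Y @^-1` A `&` Z @^-1` A')).
  rewrite -[X @^-1` (A `*` A')]/(Y @^-1` A `&` Z @^-1` A').
  rewrite (indep_of_prob Yind Jj Gj)// fineK// -/c muleC -muleA -setIA.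
  have sj : j \notin s by apply/negP => /GB[[_ /=]].
  (* On a rectangle the event of Z joins the family at index j, which is not in s since s is drawn
     from [J] without j; the product rule of Y then applies to j :: s. *)
  pose B' i := if i == j then Z @^-1` A' else B i.
  have B'j : B' j = Z @^-1` A' by rewrite /B' eqxx.
  have BB' : {in s, B' =1 B}.
    by move=> i si; rewrite /B'; case: eqP => // ij; move: sj; rewrite -ij si.
  have := Yi A mA (j :: s) B'; rewrite cons_uniq sj us => /(_ isT).
  rewrite bigcap_seqE !big_cons B'j.
  rewrite (_ : \big[setI/setT]_(i <- s) B' i = N); last first.
    by rewrite /N big_seq [RHS]big_seq; apply: eq_bigr => i /BB' ->.
  rewrite (_ : \big[*%E/1%E]_(i <- s) P (B' i) = c); last first.
    by rewrite /c big_seq [RHS]big_seq; apply: eq_bigr => i /BB' ->.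
  apply=> i; rewrite inE => /predU1P[->|si].
    by rewrite B'j; split=> //; rewrite Gj; exists A'; rewrite ?setTI.
  by rewrite BB'//; have [[Ji _] ?] := GB i si.
rewrite /m1 /m1' /m2 /= /mscale /distribution /pushforward /mrestr/= => ->.
by rewrite fineK// muleC.
Qed.

(** The law of (Y, Z) is the product of the law of Y and Q, so Tonelli integrates Z out with Y
    frozen. This replaces conditioning on the past. *)
Lemma ge0_integral_indep (J : set I) (Y : Omega -> S) (j : I) (Z : {RV P >-> E})
    (Q : probability E R) (phi : (S * E)%type -> \bar R) :
  indep_of P G J Y -> J j -> G j = preimage_set_system setT Z measurable ->
  has_law Z Q ->
  measurable_fun [set: (S * E)%type] phi -> (forall z, 0 <= phi z)%E ->
  (\int[P]_w phi (Y w, Z w) = \int[P]_w \int[Q]_z phi (Y w, z))%E.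
Proof.
move=> Yind Jj Gj ZQ mphi phi0; have [mY _] := Yind.
have mYZ : measurable_fun setT (fun w => (Y w, Z w)).
  exact: measurable_fun_pair.
pose X : {RV P >-> (S * E)%type} := mkRV mYZ.
pose Y' : {RV P >-> S} := mkRV mY.
rewrite -(@ge0_integral_distribution _ _ _ _ _ P X)//.
rewrite (@eq_measure_integral _ _ _ _ (distribution P Y' \x Q)%E); last first.
  move=> A mA _; apply/esym.
  apply: (@product_measure_unique _ _ _ _ _ (distribution P Y') Q (distribution P X)) => //.
  move=> A1 A2 mA1 mA2; apply: (etrans (indep_of_prob Yind Jj Gj mA1 mA2)).
  by congr (_ * _)%E; exact: ZQ.
rewrite fubini_tonelli1//.
rewrite (@ge0_integral_distribution _ _ _ _ _ P Y' (fubini_F Q phi))//.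
  exact: measurable_fun_fubini_tonelli_F.
by move=> y; exact: integral_ge0.
Qed.

End independence.

(** * Measurability and moments of random vectors *)

Definition vmeas {R : realType} {dT : measure_display} {T : measurableType dT}
  {d : nat} (h : T -> 'rV[R]_d) : Prop :=
  forall i, measurable_fun setT (fun x => h x 0 i).

Section vector_measurability.
Context (R : realType) (dT : measure_display) (T : measurableType dT) (d : nat).
Implicit Types u v : T -> 'rV[R]_d.

Lemma vmeas_cst (v : 'rV[R]_d) : vmeas (fun _ : T => v).
Proof. by move=> i; exact: measurable_cst. Qed.

Lemma vmeasD u v : vmeas u -> vmeas v -> vmeas (fun x => u x + v x).
Proof.
move=> mu mv i; under eq_fun do rewrite mxE.
exact: (measurable_funD (mu i) (mv i)).
Qed.

Lemma vmeasZ (a : T -> R) v : measurable_fun setT a -> vmeas v ->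
  vmeas (fun x => a x *: v x).
Proof.
move=> ma mv i; under eq_fun do rewrite mxE.
exact: (measurable_funM ma (mv i)).
Qed.

Lemma vmeasN v : vmeas v -> vmeas (fun x => - v x).
Proof.
move=> mv i; under eq_fun do rewrite mxE.
exact: (measurable_funN (mv i)).
Qed.

Lemma vmeasB u v : vmeas u -> vmeas v -> vmeas (fun x => u x - v x).
Proof. by move=> mu mv; apply: vmeasD => //; exact: vmeasN. Qed.

Lemma vmeas_mulmx v (A : T -> 'M[R]_d) : vmeas v ->
  (forall i j, measurable_fun setT (fun x => A x i j)) ->
  vmeas (fun x => v x *m A x).
Proof.
move=> mv mA j; under eq_fun do rewrite mxE.
by apply: measurable_sum => i; exact: (measurable_funM (mv i) (mA i j)).
Qed.

Lemma measurable_enorm v : vmeas v -> measurable_fun setT (fun x => enorm (v x)).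
Proof.
move=> mv.
apply: (measurableT_comp (continuous_measurable_fun (@sqrt_continuous R))).
by apply: measurable_sum => i; exact: (measurable_funX 2 (mv i)).
Qed.

Lemma measurable_enorm_powR v p : vmeas v ->
  measurable_fun setT (fun x => (enorm (v x) `^ p)%:E).
Proof.
move=> mv; apply/measurable_EFinP.
exact: (measurableT_comp (measurable_powR p) (measurable_enorm mv)).
Qed.

(** The inverse is split into powers -1 of the positive and negative parts; at 0 both powers are 0,
    in agreement with 0^-1 = 0. *)
Lemma measurable_invr : measurable_fun setT (@GRing.inv R).
Proof.
apply: (eq_measurable_fun
  (fun x : R => Num.max x 0 `^ (-1) - Num.max (- x) 0 `^ (-1) : R)).
  move=> x _ /=; rewrite !powR_inv1 ?le_max ?lexx ?orbT//.
  have [x0|x0] := leP 0 x.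
    by rewrite (max_idPr _) ?oppr_le0// invr0 subr0.
  by rewrite (max_idPl _) ?oppr_ge0 ?ltW// invr0 sub0r invrN opprK.
apply: measurable_funB.
  apply: (measurableT_comp (measurable_powR _)).
  exact: measurable_maxr.
apply: (measurableT_comp (measurable_powR _)).
by apply: measurable_maxr => //; exact: measurable_funN.
Qed.

Lemma vmeas_normalize v : vmeas v -> vmeas (fun x => normalize (v x)).
Proof.
move=> mv; apply: vmeasZ => //.
exact: (measurableT_comp measurable_invr (measurable_enorm mv)).
Qed.

Definition tuple_of_vec (v : 'rV[R]_d) : d.-tuple R := [tuple v 0 i | i < d].

Lemma tuple_of_vecK : cancel tuple_of_vec (@vec_of_tuple R d).
Proof. by move=> v; apply/rowP => i; rewrite mxE tnth_mktuple. Qed.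

Lemma measurable_tuple_of_vec v : vmeas v ->
  measurable_fun setT (fun x => tuple_of_vec (v x)).
Proof.
move=> mv; apply/measurable_fun_tnthP => i.
by apply: eq_measurable_fun (mv i) => x _ /=; rewrite tnth_mktuple.
Qed.

Lemma vmeas_vec_of_tuple (v : T -> d.-tuple R) : measurable_fun setT v ->
  vmeas (fun x => vec_of_tuple (v x)).
Proof.
move=> /measurable_fun_tnthP mv i.
by apply: eq_measurable_fun (mv i) => x _ /=; rewrite mxE.
Qed.

Context (dX : measure_display) (Xi : measurableType dX).

Lemma jointly_measurable_comp (h : 'rV[R]_d -> Xi -> R) v (z : T -> Xi) :
  jointly_measurable h -> vmeas v -> measurable_fun setT z ->
  measurable_fun setT (fun x => h (v x) (z x)).
Proof.
move=> mh mv mz.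
have := measurableT_comp mh
  (measurable_fun_pair (measurable_tuple_of_vec mv) mz).
by apply: eq_measurable_fun => x _ /=; rewrite tuple_of_vecK.
Qed.

(** This makes grad F measurable as the mean of its oracle. Tonelli is applied to the positive and
    negative parts of the oracle separately. *)
Lemma measurable_expectation_param (D : probability Xi R)
    (h : 'rV[R]_d -> Xi -> R) (m : 'rV[R]_d -> R) v :
  jointly_measurable h -> (forall x, 'E_D[h x] = (m x)%:E)%E -> vmeas v ->
  measurable_fun setT (fun x => m (v x)).
Proof.
move=> mh Em mv; apply/measurable_EFinP.
pose k := fun y : d.-tuple R * Xi => (h (vec_of_tuple y.1) y.2)%:E.
have mk : measurable_fun [set: (d.-tuple R * Xi)%type] k by exact/measurable_EFinP.
have mp : measurable_fun setT (fubini_F D (k^\+)%E).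
  by apply: measurable_fun_fubini_tonelli_F => //; exact: measurable_funepos.
have mn : measurable_fun setT (fubini_F D (k^\-)%E).
  by apply: measurable_fun_fubini_tonelli_F => //; exact: measurable_funeneg.
have := measurableT_comp (emeasurable_funB mp mn) (measurable_tuple_of_vec mv).
apply: eq_measurable_fun => x _ /=.
rewrite -Em [in RHS]unlock integralE /fubini_F; congr (_ - _)%E;
  by apply: eq_integral => z _; rewrite !(funeposE, funenegE) /k /= tuple_of_vecK.
Qed.

End vector_measurability.

(** The integral of a nonnegative function is a supremum over simple functions below it, so
    monotonicity needs no measurability. This serves for [opnorm] and for iterated integrals. *)
Lemma ge0_le_integral_dom (R : realType) (dT : measure_display)
    (T : measurableType dT) (mu : {measure set T -> \bar R}) (f g : T -> \bar R) :
  (forall x, 0 <= f x)%E -> (forall x, f x <= g x)%E ->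
  (\int[mu]_x f x <= \int[mu]_x g x)%E.
Proof.
move=> f0 fg; have g0 x : (0 <= g x)%E by exact: le_trans (fg x).
rewrite !ge0_integralTE//; apply: le_ereal_sup => _ [h hf <-].
by exists h => // x; exact: le_trans (fg x).
Qed.

Section moments.
Context (R : realType) (dT : measure_display) (T : measurableType dT).
Context (mu : probability T R) (p : R).
Hypothesis p12 : 1 < p <= 2.

Lemma integral_cst_probability (c : \bar R) : (\int[mu]_x c = c)%E.
Proof.
rewrite (integral_cst mu (@measurableT _ T) c) -[RHS]mule1; congr (_ * _)%E.
exact: probability_setT.
Qed.

Lemma ler_1DpowR (x : R) : 0 <= x -> x <= 1 + x `^ p.
Proof.
move=> x0; have [x1|x1] := leP x 1; first by rewrite (le_trans x1)// lerDl powR_ge0.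
apply: (@le_trans _ _ (x `^ p)); last by rewrite lerDr.
by rewrite -{1}(powRr1 x0) ler_powR ?(ltW x1)//; have /andP[/ltW] := p12.
Qed.

Lemma integrable_powR (X : T -> R) (M : R) : measurable_fun setT X ->
  (\int[mu]_x (`|X x| `^ p)%:E <= M%:E)%E -> mu.-integrable setT (EFin \o X).
Proof.
move=> mX XM; apply/integrableP; split; first exact/measurable_EFinP.
apply: (@le_lt_trans _ _ (\int[mu]_x (1 + (`|X x| `^ p)%:E))%E).
  apply: ge0_le_integral_dom => // x /=.
  by rewrite -EFinD lee_fin ler_1DpowR.
rewrite ge0_integralD//.
- rewrite integral_cst_probability.
  by rewrite (@le_lt_trans _ _ (1 + M%:E)%E)// ?leeD2l// -EFinD ltry.
- apply/measurable_EFinP; apply: (measurableT_comp (measurable_powR _)).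
  exact: (measurableT_comp (@normr_measurable R setT)).
Qed.

(** The integrated form of [enormD_powR]: the cross term is linear in X with coefficients [c i], so
    centering kills it coordinate by coordinate. The moment bound supplies the integrability needed
    to split the integral. *)
Lemma integral_enormD_powR d (X : T -> 'rV[R]_d) (M : R) (a : 'rV[R]_d) :
  vmeas X -> (forall i, \int[mu]_x (X x 0 i)%:E = 0)%E ->
  (\int[mu]_x (enorm (X x) `^ p)%:E <= M%:E)%E ->
  (\int[mu]_x (enorm (a + X x) `^ p)%:E <= (enorm a `^ p + 6 * M)%:E)%E.
Proof.
move=> mX X0 XM.
have iX i : mu.-integrable setT (EFin \o (fun x => X x 0 i)).
  apply: (@integrable_powR _ M) => //.
  apply: le_trans XM; apply: ge0_le_integral_dom => x.
    by rewrite lee_fin powR_ge0.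
  rewrite lee_fin ge0_ler_powR ?nnegrE ?enorm_ge0// ?coord_le_enorm//.
  by have /andP[p1 _] := p12; rewrite (le_trans ler01)// ltW.
have iN : mu.-integrable setT (fun x => (enorm (X x) `^ p)%:E).
  apply/integrableP; split; first exact: measurable_enorm_powR.
  rewrite (le_lt_trans _ (ltry M))//; apply: le_trans XM.
  by apply: ge0_le_integral_dom => // x; rewrite abse_EFin ger0_norm ?powR_ge0.
pose c i := p * enorm a `^ (p - 2) * a 0 i.
pose S x := (\sum_(i < d) (c i)%:E * (X x 0 i)%:E)%E.
have iS : mu.-integrable setT S.
  by apply: integrable_sum => // i _; apply: integrableZl => //; exact: iX.
have i1 : mu.-integrable setT (cst (enorm a `^ p)%:E).
  exact: finite_measure_integrable_cst.
have i6 : mu.-integrable setT (fun x => 6%:E * (enorm (X x) `^ p)%:E)%E.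
  exact: integrableZl.
have i1S : mu.-integrable setT (fun x => cst (enorm a `^ p)%:E x + S x)%E.
  exact: integrableD.
apply: (@le_trans _ _ (\int[mu]_x
    (cst (enorm a `^ p)%:E x + S x + 6%:E * (enorm (X x) `^ p)%:E))%E).
  apply: ge0_le_integral_dom => x; first by rewrite lee_fin powR_ge0.
  rewrite /S /=; under eq_bigr do rewrite -EFinM.
  rewrite sumEFin -!EFinM -!EFinD lee_fin (le_trans (enormD_powR _ _ p12))//.
  rewrite le_eqVlt; apply/orP; left; apply/eqP; congr (_ + _ + _).
  by rewrite /edot mulr_sumr; apply: eq_bigr => i _; rewrite /c mulrA.
rewrite integralD// integralD// integral_cst_probability.
rewrite integral_sum//; last by move=> i; apply: integrableZl => //; exact: iX.
rewrite big1 ?adde0; last first.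
  by move=> i _; rewrite integralZl ?X0 ?mule0//; exact: iX.
rewrite integralZl// [leRHS]EFinD; apply: leeD2l.
by rewrite EFinM lee_pmul2l.
Qed.

End moments.

(** * Smooth functions *)

Section real_calculus.
Context (R : realType).
Implicit Types (g : R -> R).

(** Only the steps 1/(n+1) are kept, since measurability of limits and dominated convergence work
    along sequences. *)
Lemma cvg_diff_quotient g (l t : R) : is_derive t 1 g l ->
  (fun n => n.+1%:R * (g (t + n.+1%:R^-1) - g t)) @ \oo --> l.
Proof.
move=> [gt <-].
have h0 : (@harmonic R) @ \oo --> 0^'.
  move=> A /nbhs_ballP[e /= e0 eA]; have /cvgrPdist_lt/(_ e e0) := @cvg_harmonic R.
  by apply: filterS => n /= ne; apply: eA => //=; rewrite invr_eq0 pnatr_eq0.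
have := cvg_comp _ _ h0 gt.
apply: cvg_trans; apply: near_eq_cvg; apply: nearW => n /=.
by rewrite invrK [_%:A]mulr1 [_ + t]addrC.
Qed.

Lemma derive_lipschitz_le g (l t K : R) : is_derive t 1 g l ->
  (forall s, g s - g t <= K * `|s - t|) -> l <= K.
Proof.
move=> /cvg_diff_quotient gt Kg; apply: (cvgr_to_le gt); apply: nearW => n /=.
rewrite mulrC -ler_pdivlMr// (le_trans (Kg _))// [t + _]addrC addrK.
by rewrite ger0_norm.
Qed.

Lemma lipschitz_continuous g (K : R) :
  (forall s t, `|g s - g t| <= K * `|s - t|) -> continuous g.
Proof.
move=> Kg t; apply/cvgrPdist_le => e e0.
have K1 : 0 < `|K| + 1 by rewrite ltr_wpDl.
near=> s; rewrite (le_trans (Kg t s))//.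
apply: (@le_trans _ _ ((`|K| + 1) * `|t - s|)).
  by rewrite ler_wpM2r// (le_trans (ler_norm K))// lerDl.
rewrite -ler_pdivlMl//; near: s.
by apply: cvgr_dist_le => //; rewrite mulr_gt0// invr_gt0.
Unshelve. all: by end_near. Qed.

Lemma measurable_is_derive g g' : (forall t : R, is_derive t 1 g (g' t)) ->
  measurable_fun setT g'.
Proof.
move=> gg'.
have cg : continuous g.
  move=> t; apply/differentiable_continuous/derivable1_diffP.
  by have [] := gg' t.
apply: (@measurable_fun_cvg _ R R setT
  (fun n t => n.+1%:R * (g (t + n.+1%:R^-1) - g t)) g'); last first.
  by move=> t _; exact: cvg_diff_quotient.
move=> n; apply: measurable_funM; first exact: measurable_cst.
apply: measurable_funB; last exact: continuous_measurable_fun.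
apply: (measurableT_comp (continuous_measurable_fun cg)).
by apply: measurable_funD => //; exact: measurable_cst.
Qed.

(* [g'] may be discontinuous: by dominated convergence its integral is the limit of
   the integrals of the difference quotients of [g], which are themselves difference
   quotients of a primitive of [g]. *)
Lemma integral_is_derive_lipschitz g g' (K : R) :
  (forall t : R, is_derive t 1 g (g' t)) ->
  (forall s t, `|g s - g t| <= K * `|s - t|) ->
  (\int[lebesgue_measure]_(t in `[0%R, 1%R]) (g' t)%:E = (g 1 - g 0)%:E)%E.
Proof.
move=> gg' Kg; have cg := lipschitz_continuous Kg.
(* Starting the primitive at -1 keeps 0 interior, so [Phi] is differentiable at both endpoints of
   [0, 1]. *)
pose Phi x := \int[lebesgue_measure]_(t in [set` `[(-1 : R), x]]) g t.
have PhiD (x : R) : -1 < x -> is_derive x 1 Phi (g x).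
  move=> x1; have := @continuous_FTC1_closed R g (-1) x (x + 1).
  rewrite ltrDl ltr01 => /(_ isT) /(_ _ x1 (cg x)) [].
    apply: continuous_compact_integrable; first exact: segment_compact.
    exact: continuous_subspaceT.
  by move=> dPhi PhiE; apply: (DeriveDef dPhi); rewrite -PhiE derive1E.
pose f n t := n.+1%:R * (g (t + n.+1%:R^-1) - g t).
pose G n t := n.+1%:R * (Phi (t + n.+1%:R^-1) - Phi t).
have GD n (t : R) : -1 < t -> is_derive t 1 (G n) (f n t).
  move=> t1.
  have t1' : -1 < t + n.+1%:R^-1 by rewrite (lt_le_trans t1)// lerDl.
  have := PhiD _ t1'; have := PhiD _ t1 => d1 d2.
  have d3 : is_derive t 1 (fun s => Phi (s + n.+1%:R^-1)) (g (t + n.+1%:R^-1)).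
    have := @is_derive1_comp R Phi (shift n.+1%:R^-1) t _ _ d2 (is_derive_shift _ _ _).
    by rewrite mulr1.
  have := is_deriveZ n.+1%:R (is_deriveB d3 d1).
  by [].
have cf n : continuous (f n).
  move=> t; apply: cvgM; first exact: cvg_cst.
  apply: cvgB; last exact: cg.
  apply: (cvg_comp (fun s => s + n.+1%:R^-1) g); last exact: cg.
  by apply: cvgD; [exact: cvg_id|exact: cvg_cst].
have cG n (t : R) : -1 < t -> {for t, continuous (G n)}.
  move=> t1; apply/differentiable_continuous/derivable1_diffP.
  by have [] := GD n t t1.
have intf n : (\int[lebesgue_measure]_(t in `[0%R, 1%R]) (f n t)%:E
    = (G n 1 - G n 0)%:E)%E.
  rewrite (@continuous_FTC2 R (f n) (G n))//.
  - exact: continuous_subspaceT.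
  - split.
    + move=> t /=; rewrite in_itv/= => /andP[t0 _].
      by have [] := GD n t (lt_trans (ltrN10 _) t0).
    + by apply: cvg_at_right_filter; apply: cG.
    + by apply: cvg_at_left_filter; apply: cG.
  - move=> t; rewrite in_itv/= => /andP[t0 _]; rewrite derive1E.
    by have [_ ->] := GD n t (lt_trans (ltrN10 _) t0).
(* [G n] is the difference quotient of [Phi], so its values at 1 and 0 tend to the derivatives of
   [Phi] there, which are g 1 and g 0. *)
have h2 : (fun n => (G n 1 - G n 0)%:E) @ \oo --> (g 1 - g 0)%:E.
  apply: cvg_EFin; first exact: nearW.
  by apply: cvgB; apply: cvg_diff_quotient; apply: PhiD.
pose I01 := [set` `[(0 : R), 1]].
have mI : measurable I01 by exact: measurable_itv.
have mf n : measurable_fun I01 (fun t => (f n t)%:E).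
  apply/measurable_EFinP; apply: measurable_funTS.
  exact: continuous_measurable_fun (cf n).
have mg' : measurable_fun I01 (EFin \o g').
  by apply/measurable_EFinP/measurable_funTS; exact: measurable_is_derive gg'.
have fg' : {ae lebesgue_measure, forall t, I01 t ->
    (f n t)%:E @[n --> \oo] --> (EFin \o g') t}.
  apply: aeW => t _; apply: cvg_EFin; first exact: nearW.
  exact: cvg_diff_quotient (gg' t).
have iK : lebesgue_measure.-integrable I01 (EFin \o cst K).
  apply: continuous_compact_integrable; first exact: segment_compact.
  by apply: continuous_subspaceT => ?; exact: cvg_cst.
have bd : {ae lebesgue_measure, forall t n, I01 t ->
    (`|(f n t)%:E| <= (EFin \o cst K) t)%E}.
  apply: aeW => t n _; rewrite /= lee_fin /f normrM ger0_norm//.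
  rewrite mulrC -ler_pdivlMr// (le_trans (Kg _ _))// [t + _]addrC addrK.
  by rewrite ger0_norm.
have [_ _] := @dominated_convergence _ _ R (@lebesgue_measure R) _ mI _ _ _ mf mg' fg' iK bd.
under eq_fun do rewrite intf.
by move=> /cvg_unique/(_ h2); apply.
Qed.

(* MathComp-Analysis gives [uniform_prob] on [measurableTypeR R], whose measurable
   structure is not convertible to the one declared on [R] itself. *)
Lemma measurable_idR :
  @measurable_fun _ _ (measurableTypeR R) (R : measurableType _) setT id.
Proof. exact: (@measurable_id _ (measurableTypeR R) setT). Qed.

Definition unif01 : probability R R :=
  distribution (uniform_prob (@ltr01 R)) (mkRV (P := uniform_prob (@ltr01 R)) measurable_idR).

(** The density formula is applied to the nonnegative function h + M; the integral of M is M on both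
    sides and cancels. *)
Lemma integral_uniform01 (h : R -> R) (M : R) :
  measurable_fun setT h -> (forall t, `|h t| <= M) ->
  (\int[unif01]_t (h t)%:E =
   \int[lebesgue_measure]_(t in `[0%R, 1%R]) (h t)%:E)%E.
Proof.
move=> mh hM.
have hM0 t : (0 <= (h t)%:E + M%:E)%E.
  by rewrite -EFinD lee_fin -lerBlDr sub0r; have := hM t; rewrite ler_norml => /andP[].
have mhE D : measurable_fun D (EFin \o h).
  by apply: measurable_funTS; exact/measurable_EFinP.
have ih1 : (uniform_prob (@ltr01 R)).-integrable setT (EFin \o h).
  apply: le_integrable (finite_measure_integrable_cst _ M (@measurableT _ _)) => //.
    exact: mhE.
  by move=> t _ /=; rewrite lee_fin (le_trans (hM t))// ler_norm.
have iM : lebesgue_measure.-integrable [set` `[(0 : R), 1]] (EFin \o cst M).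
  apply: continuous_compact_integrable; first exact: segment_compact.
  by apply: continuous_subspaceT => ?; exact: cvg_cst.
have ih2 : lebesgue_measure.-integrable [set` `[(0 : R), 1]] (EFin \o h).
  apply: le_integrable iM => //.
    exact: mhE.
  by move=> t _ /=; rewrite lee_fin (le_trans (hM t))// ler_norm.
transitivity (\int[uniform_prob (@ltr01 R)]_t (h t)%:E)%E.
  by apply: integral_distribution => //; exact: mhE.
have : (\int[uniform_prob (@ltr01 R)]_t ((h t)%:E + M%:E) =
   \int[lebesgue_measure]_(t in `[0%R, 1%R]) ((h t)%:E + M%:E))%E.
  rewrite (integral_uniform (@ltr01 R))//; last first.
    by apply: emeasurable_funD => //; exact: mhE.
  by rewrite subr0 invr1 mul1e.
rewrite (integralD (@measurableT _ _) ih1 (finite_measure_integrable_cst _ M (@measurableT _ _))).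
rewrite (integralD _ ih2 iM)// (integral_cst_probability _ M%:E).
rewrite [X in _ = (_ + X)%E -> _](_ : _ = M%:E); last first.
  rewrite -[RHS]mule1 -(_ : lebesgue_measure [set` `[(0 : R), 1]] = 1%E).
    exact: (integral_cst (@lebesgue_measure R) (measurable_itv `[(0 : R), 1]) M%:E).
  by rewrite lebesgue_measure_itv/= lte_fin ltr01 oppr0 adde0.
by move=> /(congr1 (fun z => z - M%:E)%E); rewrite !addeK.
Qed.

Lemma is_derive_mulr (c t : R) : is_derive t 1 (fun s : R => s * c) c.
Proof.
have := is_deriveZ c (is_derive_id t (1 : R)).
rewrite [X in is_derive _ _ X _](_ : _ = (fun s : R => s * c)); last first.
  by apply/funext => s; rewrite mulrC.
by rewrite /GRing.scale/= mulr1.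
Qed.

Lemma is_derive_mul_sqr (k t : R) :
  is_derive t 1 (fun s : R => k * s ^+ 2) (2 * k * t).
Proof.
have := is_deriveZ k (is_deriveM (is_derive_id t (1 : R)) (is_derive_id t (1 : R))).
rewrite [X in is_derive _ _ X _](_ : _ = (fun s : R => k * s ^+ 2)); last first.
  by apply/funext => s; rewrite expr2.
move=> h; apply: (is_derive_eq h); rewrite /GRing.scale/=; ring.
Qed.

Context (d : nat).
Implicit Types (x v : 'rV[R]_d) (F : 'rV[R]_d -> R).

Lemma is_derive_line F x v (t : R) : differentiable F (x + t *: v) ->
  is_derive t 1 (fun s => F (x + s *: v)) ('D_v F (x + t *: v)).
Proof.
move=> dF.
have E : (fun h : R => h^-1 *: (((fun s => F (x + s *: v)) \o shift t) h%:A -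
      F (x + t *: v))) =
    (fun h => h^-1 *: ((F \o shift (x + t *: v)) (h *: v) - F (x + t *: v))).
  apply/funext => h /=; congr (_ *: (F _ - _)).
  by rewrite [_%:A]mulr1 scalerDl addrCA.
apply: DeriveDef; first by rewrite /derivable E; exact: diff_derivable.
by rewrite /derive E.
Qed.

Lemma derive_grad F x v : differentiable F x -> 'D_v F x = edot (grad F x) v.
Proof.
move=> dF; rewrite deriveE// [in LHS](row_sum_delta v) linear_sum.
by apply: eq_bigr => i _; rewrite linearZ mxE deriveE// mulrC.
Qed.

Lemma derive_grad_coord F x v i : differentiable (grad F) x ->
  'D_v (fun y => grad F y 0 i) x = (v *m hessian F x) 0 i.
Proof.
move=> dF; rewrite /hessian -deriveEjacobian//.
by rewrite derive_mx ?mxE//; exact: diff_derivable.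
Qed.

Lemma differentiable_grad_coord F x i : differentiable (grad F) x ->
  differentiable (fun y => grad F y 0 i) x.
Proof.
move=> dF; apply: (@differentiable_comp _ _ _ _ (grad F) (fun u => u 0 i : R)) => //.
exact: differentiable_coord.
Qed.

(** * Consequences of L-smoothness for increments, minimizers and Hessians *)

Section smooth.
Context (L : R) (F : 'rV[R]_d -> R).
Hypothesis F_smooth : smooth L F.

(** [phi] is F along the segment minus the linear and quadratic terms of the bound. Cauchy-Schwarz
    and the Lipschitz gradient make its derivative nonpositive on (0, 1), so one use of the mean
    value theorem gives phi 1 <= phi 0. *)
Lemma smooth_le x y :
  F y <= F x + edot (grad F x) (y - x) + L / 2 * enorm (y - x) ^+ 2.
Proof.
have [dF LF] := F_smooth; pose v := y - x.
pose phi (t : R) := F (x + t *: v) - (t * edot (grad F x) v + L / 2 * enorm v ^+ 2 * t ^+ 2).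
pose phi' (t : R) := edot (grad F (x + t *: v)) v -
  (edot (grad F x) v + L * enorm v ^+ 2 * t).
have phiD (t : R) : is_derive t 1 phi (phi' t).
  have d1 := is_derive_line (dF (x + t *: v)).
  rewrite derive_grad// in d1.
  have d2 : is_derive t 1 (fun t : R => t * edot (grad F x) v + L / 2 * enorm v ^+ 2 * t ^+ 2)
      (edot (grad F x) v + L * enorm v ^+ 2 * t).
    apply: (is_derive_eq (is_deriveD (is_derive_mulr _ t) (is_derive_mul_sqr _ t))).
    by field.
  exact: (is_deriveB d1 d2).
have [c c01] : exists2 c, c \in `]0, 1[ & phi 1 - phi 0 = phi' c * (1 - 0).
  apply: MVT => //; apply: derivable_within_continuous => t _.
  by have [] := phiD t.
rewrite in_itv/= in c01; have /andP[c0 c1] := c01.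
rewrite subr0 mulr1 => phiE.
have phi'0 : phi' c <= 0.
  have -> : phi' c = edot (grad F (x + c *: v) - grad F x) v - L * enorm v ^+ 2 * c.
    by rewrite /phi' edotDl edotNl; ring.
  rewrite subr_le0 (le_trans (edot_le _ _))//.
  apply: le_trans (_ : L * enorm (c *: v) * enorm v <= _).
    rewrite ler_wpM2r ?enorm_ge0// (le_trans (LF _ _))//.
    by rewrite [_ + _ *: _]addrC addrK.
  by rewrite enormZ gtr0_norm// le_eqVlt; apply/orP; left; apply/eqP; ring.
move: phi'0; rewrite -phiE /phi scale1r scale0r addr0 [x + v]addrC subrK.
by rewrite -/v; lra.
Qed.

(** A gradient step from a minimizer would decrease F. Its length factor is 1/(L+1) rather than 1/L
    so that L = 0 is allowed. *)
Lemma grad_eq0_of_min x : 0 <= L -> (forall y, F x <= F y) -> grad F x = 0.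
Proof.
move=> L0 Fx; apply: enorm_eq0.
have L1 : 0 < L + 1 by lra.
have := smooth_le x (x - (L + 1)^-1 *: grad F x).
have -> : x - (L + 1)^-1 *: grad F x - x = - ((L + 1)^-1 *: grad F x).
  by rewrite addrAC subrr sub0r.
rewrite edotNr edotZr -sqr_enorm enormN enormZ normfV gtr0_norm//.
move=> /(le_trans (Fx _)); rewrite exprMn.
set g := enorm _ ^+ 2 => h.
have g0 : 0 <= g by exact: sqr_ge0.
have : g * ((L + 1)^-1 * (1 - L / 2 * (L + 1)^-1)) <= 0.
  rewrite -subr_ge0; move: h; rewrite -subr_ge0 expr2; congr (0 <= _); ring.
have s0 : 0 < (L + 1)^-1 * (1 - L / 2 * (L + 1)^-1).
  rewrite mulr_gt0 ?invr_gt0// subr_gt0 ltr_pdivrMr// mul1r; lra.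
rewrite pmulr_lle0// => g0'; apply/eqP; rewrite -sqrf_eq0; apply/eqP/le_anti.
by rewrite g0 g0'.
Qed.

Lemma is_derive_grad_line x v i (t : R) : differentiable (grad F) (x + t *: v) ->
  is_derive t 1 (fun s => grad F (x + s *: v) 0 i)
    ((v *m hessian F (x + t *: v)) 0 i).
Proof.
move=> dG; rewrite -(derive_grad_coord v i dG).
exact: (is_derive_line (differentiable_grad_coord _ _)).
Qed.

(** With w the image of v, the function t |-> <w, grad F (x + t v)> has derivative |w|^2 at 0 and
    Lipschitz constant |w| L |v|; dividing by |w| gives the bound. *)
Lemma enorm_hessian_le x v : 0 <= L -> differentiable (grad F) x ->
  enorm (v *m hessian F x) <= L * enorm v.
Proof.
move=> L0 dG; have [dF LF] := F_smooth.
pose w := v *m hessian F x.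
have w0 := enorm_ge0 w.
suff h : edot w w <= enorm w * (L * enorm v).
  have [->|wn0] := eqVneq (enorm w) 0; first by rewrite mulr_ge0 ?enorm_ge0.
  rewrite -(@ler_pM2l _ (enorm w)) ?lt_neqAle ?(eq_sym 0) ?wn0//.
  by rewrite -expr2 sqr_enorm.
pose g (t : R) := edot w (grad F (x + t *: v)).
have gD : is_derive (0 : R) 1 g (edot w w).
  have dG' : differentiable (grad F) (x + (0 : R) *: v) by rewrite scale0r addr0.
  have := is_derive_sum (fun i => is_deriveZ (w 0 i) (is_derive_grad_line i dG')).
  rewrite scale0r addr0 => h; apply: is_derive_eq; last by [].
  rewrite (_ : g = \sum_(i < d) (w 0 i *: fun s => grad F (x + s *: v) 0 i)) //.
  apply/funext => t; rewrite fct_sumE; apply: eq_bigr => i _.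
  by [].
apply: (derive_lipschitz_le gD) => s.
rewrite /g -edotNr -edotDr (le_trans (edot_le _ _))// -mulrA ler_wpM2l//.
rewrite (le_trans (LF _ _))// -mulrA ler_wpM2l//.
rewrite scale0r addr0 subr0 [x + _]addrC addrK enormZ mulrC//.
Qed.

(** This is what the uniform q achieves: the Hessian-vector product at a uniform point of the
    segment is an unbiased estimate of the gradient increment, whatever the variation of the
    Hessian. *)
Lemma integral_hessian_line x v i :
  (forall y, differentiable (grad F) y) -> 0 <= L ->
  (\int[unif01]_t
     ((v *m hessian F (x + t *: v) - (grad F (x + v) - grad F x)) 0 i)%:E = 0)%E.
Proof.
move=> dG L0; have [dF LF] := F_smooth.
pose c := (grad F (x + v) - grad F x) 0 i.
pose h (t : R) := (v *m hessian F (x + t *: v)) 0 i.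
(* Subtracting t c makes the values at 0 and 1 equal, so the integral of the derivative h - c
   vanishes. *)
pose g (t : R) := grad F (x + t *: v) 0 i - t * c.
have gD (t : R) : is_derive t 1 g (h t - c).
  have d1 : is_derive t 1 (fun s : R => s * c) c.
    exact: is_derive_mulr.
  exact: (is_deriveB (is_derive_grad_line i (dG (x + t *: v))) d1).
have Kg s t : `|g s - g t| <= (2 * (L * enorm v)) * `|s - t|.
  have -> : g s - g t = (grad F (x + s *: v) - grad F (x + t *: v)) 0 i - (s - t) * c.
    by rewrite /g !mxE; ring.
  have -> : 2 * (L * enorm v) * `|s - t| =
    L * (`|s - t| * enorm v) + `|s - t| * (L * enorm v) by ring.
  rewrite (le_trans (ler_normB _ _))// lerD//.
    rewrite (le_trans (coord_le_enorm _ _))// (le_trans (LF _ _))//.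
    by rewrite opprD addrACA subrr add0r -scalerBl enormZ.
  rewrite normrM ler_wpM2l// (le_trans (coord_le_enorm _ _))//.
  by rewrite (le_trans (LF _ _))// [x + v]addrC addrK.
have mh : measurable_fun setT (fun t => h t - c) by exact: measurable_is_derive gD.
under eq_integral do rewrite mxE [X in _ + X]mxE -/(h _) -/c.
rewrite (integral_uniform01 (M := 2 * (L * enorm v)))//; last first.
  move=> t; have -> : 2 * (L * enorm v) = L * enorm v + L * enorm v by ring.
  rewrite (le_trans (ler_normB _ _))// lerD//.
    by rewrite (le_trans (coord_le_enorm _ _))// enorm_hessian_le.
  rewrite (le_trans (coord_le_enorm _ _))//.
  by rewrite (le_trans (LF _ _))// [x + v]addrC addrK.
rewrite (integral_is_derive_lipschitz gD Kg) /g /c scale1r scale0r addr0 !mxE.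
by rewrite mul1r mul0r subr0 subKr subrr.
Qed.

End smooth.
End real_calculus.

(** * Moments of one iteration *)

(** [sup] dominates its set only if the set is bounded above; the sum of the absolute values of all
    entries is such a bound. *)
Lemma enorm_mulmx_le_opnorm (R : realType) d (v : 'rV[R]_d) (A : 'M[R]_d) :
  enorm v <= 1 -> enorm (v *m A) <= opnorm A.
Proof.
move=> v1; apply: ub_le_sup; last by exists v.
exists (\sum_j \sum_i `|A i j|) => _ [u u1 <-].
rewrite (le_trans (enorm_le_sum _))//; apply: ler_sum => j _; rewrite mxE.
rewrite (le_trans (ler_norm_sum _ _ _))//; apply: ler_sum => i _.
by rewrite normrM ler_piMl// (le_trans (coord_le_enorm u i)).
Qed.

Section centered_moments.
Context (R : realType) (dT : measure_display) (T : measurableType dT).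
Context (mu : probability T R) (p : R).
Hypothesis p12 : 1 < p <= 2.

Lemma powR_enormZ d (a : R) (u : 'rV[R]_d) : 0 <= a ->
  enorm (a *: u) `^ p = a `^ p * enorm u `^ p.
Proof. by move=> a0; rewrite enormZ ger0_norm// powRM ?enorm_ge0. Qed.

Lemma integral_powR_enormZ d (a : R) (X : T -> 'rV[R]_d) : 0 <= a -> vmeas X ->
  (\int[mu]_x (enorm (a *: X x) `^ p)%:E =
   (a `^ p)%:E * \int[mu]_x (enorm (X x) `^ p)%:E)%E.
Proof.
move=> a0 mX; rewrite -ge0_integralZl//.
- by apply: eq_integral => x _; rewrite powR_enormZ.
- exact: measurable_enorm_powR.
- by move=> x _; rewrite lee_fin powR_ge0.
- by rewrite lee_fin powR_ge0.
Qed.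

Lemma integrable_centered (h : T -> R) (m M : R) : measurable_fun setT h ->
  (\int[mu]_x (`|h x - m| `^ p)%:E <= M%:E)%E ->
  mu.-integrable setT (fun x => (h x - m)%:E).
Proof.
move=> mh hM; apply: (integrable_powR p12 _ hM).
by apply: measurable_funB => //; exact: measurable_cst.
Qed.

Lemma integral_centered (h : T -> R) (m M : R) : measurable_fun setT h ->
  (\int[mu]_x (h x)%:E = m%:E)%E ->
  (\int[mu]_x (`|h x - m| `^ p)%:E <= M%:E)%E ->
  (\int[mu]_x (h x - m)%:E = 0)%E.
Proof.
move=> mh hm hM; have ih := integrable_centered mh hM.
have im : mu.-integrable setT (EFin \o cst m).
  exact: finite_measure_integrable_cst.
have : (\int[mu]_x (h x)%:E = \int[mu]_x (h x - m)%:E + m%:E)%E.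
  rewrite -[in RHS](integral_cst_probability mu m%:E).
  rewrite -[RHS](integralD _ ih im)//.
  by apply: eq_integral => x _ /=; rewrite -EFinD subrK.
rewrite hm => /(congr1 (fun z => z - m%:E)%E).
by rewrite addeK// subee.
Qed.

(** Testing the operator norm on basis vectors bounds every entry of A - B, so the entries inherit a
    p-th moment, are integrable, and can be centered one by one. *)
Lemma integral_centered_mulmx d (v : 'rV[R]_d) (A : T -> 'M[R]_d) (B : 'M[R]_d)
    (M : R) (j : 'I_d) :
  (forall i j, measurable_fun setT (fun x => A x i j)) ->
  (forall i j, \int[mu]_x (A x i j)%:E = (B i j)%:E)%E ->
  (\int[mu]_x (opnorm (A x - B) `^ p)%:E <= M%:E)%E ->
  (\int[mu]_x ((v *m (A x - B)) 0 j)%:E = 0)%E.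
Proof.
move=> mA AB AM.
have AijM i : (\int[mu]_x (`|A x i j - B i j| `^ p)%:E <= M%:E)%E.
  apply: le_trans AM; apply: ge0_le_integral_dom => x.
    by rewrite lee_fin powR_ge0.
  have p0 : 0 <= p by have /andP[? ?] := p12; lra.
  have h : `|A x i j - B i j| <= opnorm (A x - B).
    have d1 : enorm (delta_mx 0 i : 'rV[R]_d) <= 1 by rewrite enorm_delta_mx.
    apply: le_trans (enorm_mulmx_le_opnorm (A x - B) d1).
    apply: le_trans (coord_le_enorm _ j).
    by rewrite -rowE !mxE.
  by rewrite lee_fin ge0_ler_powR ?nnegrE// (le_trans _ h).
under eq_integral.
  move=> x _; rewrite mxE -sumEFin; under eq_bigr do rewrite !mxE EFinM; over.
have iA i : mu.-integrable setT (fun x => (A x i j - B i j)%:E).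
  exact: integrable_centered (AijM i).
rewrite integral_sum//; last by move=> i; apply: integrableZl.
by apply: big1 => i _; rewrite integralZl// (integral_centered _ _ (AijM i)) ?mule0.
Qed.

(** The vector is rescaled by an upper bound r > 0 of its norm, not by the norm itself, so that v =
    0 is no exception. *)
Lemma integral_mulmx_opnorm d (v : 'rV[R]_d) (A : T -> 'M[R]_d) (r s : R) :
  0 < r -> enorm v <= r -> 
  (forall i j, measurable_fun setT (fun x => A x i j)) ->
  (\int[mu]_x (opnorm (A x) `^ p)%:E <= s%:E)%E ->
  (\int[mu]_x (enorm (v *m A x) `^ p)%:E <= (r `^ p * s)%:E)%E.
Proof.
move=> r0 vr mA As.
have p0 : 0 <= p by have /andP[? ?] := p12; lra.
pose u := r^-1 *: v.
have u1 : enorm u <= 1 by rewrite enormZ gtr0_norm ?invr_gt0// mulrC ler_pdivrMr// mul1r.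
rewrite (eq_integral (fun x => (enorm (r *: (u *m A x)) `^ p)%:E)); last first.
  by move=> x _; rewrite scalemxAl /u scalerA (mulfV (lt0r_neq0 r0)) scale1r.
rewrite (integral_powR_enormZ (ltW r0)); last by apply: vmeas_mulmx => //; exact: vmeas_cst.
rewrite [leRHS]EFinM; apply: lee_wpmul2l; first by rewrite lee_fin powR_ge0.
apply: le_trans As.
apply: ge0_le_integral_dom => x; first by rewrite lee_fin powR_ge0.
have h := enorm_mulmx_le_opnorm (A x) u1.
by rewrite lee_fin ge0_ler_powR ?nnegrE ?enorm_ge0// (le_trans (enorm_ge0 _) h).
Qed.

End centered_moments.

(** Used with f an inner integral, to add one noise contribution c per variable integrated out;
    measurability is asked of the bound g alone. *)
Lemma integral_le_addr_cst (R : realType) (dT : measure_display)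
    (T : measurableType dT) (mu : probability T R) (f : T -> \bar R) (g : T -> R)
    (M c : R) :
  0 <= c -> measurable_fun setT g -> (forall x, 0 <= g x) ->
  (forall x, 0 <= f x)%E -> (forall x, f x <= (g x + c)%:E)%E ->
  (\int[mu]_x (g x)%:E <= M%:E)%E ->
  (\int[mu]_x f x <= (M + c)%:E)%E.
Proof.
move=> c0 mg g0 f0 fg gM.
apply: (@le_trans _ _ (\int[mu]_x ((g x)%:E + c%:E))%E).
  exact: ge0_le_integral_dom.
rewrite ge0_integralD//.
- by rewrite integral_cst_probability EFinD leeD2r.
- by move=> x _; rewrite lee_fin.
- exact/measurable_EFinP.
Qed.

Definition next_g {R : realType} {d : nat} {X : Type}
    (gf : 'rV[R]_d -> X -> 'rV[R]_d) (Hf : 'rV[R]_d -> X -> 'M[R]_d)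
    (alpha : R) (xp x g : 'rV[R]_d) (q : R) (zh z : X) : 'rV[R]_d :=
  (1 - alpha) *: (g + (x - xp) *m Hf (q *: x + (1 - q) *: xp) zh) + alpha *: gf x z.

Section oracles.
Context (R : realType) (p : R).
Hypothesis p12 : 1 < p <= 2.
Context (d : nat) (dX : measure_display) (Xi : measurableType dX).
Context (D : probability Xi R) (F : 'rV[R]_d -> R).
Context (gf : 'rV[R]_d -> Xi -> 'rV[R]_d) (Hf : 'rV[R]_d -> Xi -> 'M[R]_d).
Context (L sigma sigma_h : R).
Hypotheses (L0 : 0 <= L) (F_smooth : smooth L F)
  (F_diff2 : twice_differentiable F).
Hypotheses (sigma0 : 0 < sigma) (gfP : grad_pBCM D p sigma F gf).
Hypotheses (sigma_h0 : 0 < sigma_h) (HfP : hess_pBCM D p sigma_h F Hf).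

Lemma vmeas_gf_at (x : 'rV[R]_d) : vmeas (gf x).
Proof.
move=> i; have [mg _] := gfP.
exact: (jointly_measurable_comp (mg i) (vmeas_cst x) (@measurable_id _ Xi setT)).
Qed.

Lemma measurable_Hf_at (x : 'rV[R]_d) i j : measurable_fun setT (fun z => Hf x z i j).
Proof.
have [mH _] := HfP.
exact: (jointly_measurable_comp (mH i j) (vmeas_cst x) (@measurable_id _ Xi setT)).
Qed.

Lemma vmeas_grad_noise (x : 'rV[R]_d) a : vmeas (fun z => a *: (gf x z - grad F x)).
Proof.
apply: vmeasZ; first exact: measurable_cst.
by apply: vmeasB; [exact: vmeas_gf_at|exact: vmeas_cst].
Qed.

Lemma integral_grad_noise (x : 'rV[R]_d) a i :
  (\int[D]_z ((a *: (gf x z - grad F x)) 0 i)%:E = 0)%E.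
Proof.
have [mg /(_ x) [gE gM]] := gfP.
have hM : (\int[D]_z (`|gf x z 0 i - grad F x 0 i| `^ p)%:E <= (sigma `^ p)%:E)%E.
  rewrite unlock in gM; apply: le_trans gM.
  apply: ge0_le_integral_dom => z; first by rewrite lee_fin powR_ge0.
  rewrite lee_fin ge0_ler_powR ?nnegrE ?enorm_ge0//.
    by have /andP[? ?] := p12; lra.
  by apply: le_trans (coord_le_enorm _ i); rewrite !mxE.
have := gE i; rewrite unlock => gEi.
under eq_integral do rewrite 3!mxE EFinM.
rewrite integralZl//; last first.
  by rewrite /=; apply: (integrable_centered p12 _ hM); exact: vmeas_gf_at.
rewrite (integral_centered p12 _ gEi hM) ?mule0//; exact: vmeas_gf_at.
Qed.

Lemma grad_noise_moment (x : 'rV[R]_d) a : 0 <= a ->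
  (\int[D]_z (enorm (a *: (gf x z - grad F x)) `^ p)%:E <= ((a * sigma) `^ p)%:E)%E.
Proof.
move=> a0; rewrite integral_powR_enormZ//; last first.
  by apply: vmeasB; [exact: vmeas_gf_at|exact: vmeas_cst].
rewrite powRM ?(ltW sigma0)// [leRHS]EFinM; apply: lee_wpmul2l.
  by rewrite lee_fin powR_ge0.
by have [_ /(_ x) [_]] := gfP; rewrite unlock.
Qed.

(** Integration runs from the innermost variable outwards: z costs (alpha sigma)^p, zh costs (gamma
    sigma_h)^p and q costs (2 L gamma)^p, each times 6, and what is left is the contracted old
    error. *)
Lemma moment_step (alpha gamma : R) (xp x g : 'rV[R]_d) :
  0 <= alpha <= 1 -> 0 < gamma -> enorm (x - xp) <= gamma ->
  (\int[unif01 R]_q \int[D]_zh \int[D]_z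
     (enorm (next_g gf Hf alpha xp x g q zh z - grad F x) `^ p)%:E <=
   ((1 - alpha) `^ p * enorm (g - grad F xp) `^ p +
    6 * ((2 * L * gamma) `^ p + (gamma * sigma_h) `^ p + (alpha * sigma) `^ p))%:E)%E.
Proof.
move=> /andP[a0 a1] gamma0 vgamma.
have p0 : 0 <= p by have /andP[? ?] := p12; lra.
have a1' : 0 <= 1 - alpha by rewrite subr_ge0.
have [dF dG] := F_diff2; have [_ LF] := F_smooth.
pose v := x - xp; pose v' := (1 - alpha) *: v.
have v'gamma : enorm v' <= gamma.
  rewrite enormZ ger0_norm// (le_trans _ vgamma)// ler_piMl ?enorm_ge0//.
  by rewrite lerBlDr lerDl.
(* [A0] is the inherited error. [b] compares the true Hessian at the random point with the gradient
   increment, [c] the sampled Hessian with the true one there, and [th] the sampled gradient with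
   the true one. *)
pose A0 := (1 - alpha) *: (g - grad F xp).
pose b (q : R) := (1 - alpha) *:
  (v *m hessian F (xp + q *: v) - (grad F (xp + v) - grad F xp)).
pose c (q : R) zh := v' *m (Hf (xp + q *: v) zh - hessian F (xp + q *: v)).
pose th z := alpha *: (gf x z - grad F x).
have decomp q zh z : next_g gf Hf alpha xp x g q zh z - grad F x =
    A0 + b q + c q zh + th z.
  have -> : grad F x = (1 - alpha) *: grad F x + alpha *: grad F x.
    by rewrite -scalerDl subrK scale1r.
  rewrite /next_g.
  have -> : q *: x + (1 - q) *: xp = xp + q *: v.
    by rewrite /v scalerBl scale1r scalerBr addrCA; congr (_ + _); rewrite addrC.
  rewrite opprD addrACA -!scalerBr -/(th z); congr (_ + _).
  rewrite /A0 /b /c /v' -scalemxAl -!scalerDr; congr (_ *: _).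
  rewrite mulmxBr [xp + v]addrC /v subrK -/v.
  set H1 := v *m hessian _ _; set H2 := v *m Hf _ _.
  apply/rowP => i; rewrite !mxE; ring.
have th1 q zh : (\int[D]_z
    (enorm (next_g gf Hf alpha xp x g q zh z - grad F x) `^ p)%:E <=
    (enorm (A0 + b q + c q zh) `^ p + 6 * (alpha * sigma) `^ p)%:E)%E.
  under eq_integral do rewrite decomp.
  apply: integral_enormD_powR => //; first exact: vmeas_grad_noise.
    by move=> i; exact: integral_grad_noise.
  exact: grad_noise_moment.
have c_meas q : vmeas (c q).
  apply: vmeas_mulmx; first exact: vmeas_cst.
  move=> i j; under eq_fun do rewrite !mxE.
  by apply: measurable_funB; [exact: measurable_Hf_at|exact: measurable_cst].
have th2 q : (\int[D]_zh \int[D]_z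
    (enorm (next_g gf Hf alpha xp x g q zh z - grad F x) `^ p)%:E <=
    (enorm (A0 + b q) `^ p + 6 * (gamma * sigma_h) `^ p + 6 * (alpha * sigma) `^ p)%:E)%E.
  have [mH /(_ (xp + q *: v)) [HE HM]] := HfP; rewrite unlock in HM.
  apply: (integral_le_addr_cst _ _ _ _ (th1 q)).
  - by rewrite mulr_ge0 ?powR_ge0.
  - apply/measurable_EFinP; apply: measurable_enorm_powR.
    by apply: vmeasD => //; exact: vmeas_cst.
  - by move=> zh; exact: powR_ge0.
  - by move=> zh; apply: integral_ge0 => z _; rewrite lee_fin powR_ge0.
  - apply: integral_enormD_powR => //.
      move=> j; apply: (integral_centered_mulmx p12 v' j _ _ HM).
        exact: measurable_Hf_at.
      by move=> i k; have := HE i k; rewrite unlock.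
    rewrite powRM ?(ltW gamma0) ?(ltW sigma_h0)//.
    apply: (integral_mulmx_opnorm p12 gamma0 v'gamma _ HM).
    move=> i j; under eq_fun do rewrite !mxE.
    by apply: measurable_funB; [exact: measurable_Hf_at|exact: measurable_cst].
pose b1 (q : R) := v *m hessian F (xp + q *: v) - (grad F (xp + v) - grad F xp).
have b1_meas : vmeas b1.
  apply: vmeasB; last exact: vmeas_cst.
  move=> i.
  exact: (measurable_is_derive (fun t => is_derive_grad_line i (dG (xp + t *: v)))).
(* One L gamma comes from the Hessian applied to v, the other from the gradient increment. *)
have b1_le q : enorm (b1 q) <= 2 * L * gamma.
  have -> : 2 * L * gamma = L * gamma + L * gamma by ring.
  rewrite (le_trans (enormB _ _))// lerD//.
    by rewrite (le_trans (enorm_hessian_le F_smooth v L0 (dG _)))// ler_wpM2l.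
  by rewrite (le_trans (LF _ _))// [xp + v]addrC addrK ler_wpM2l.
have b_meas : vmeas b by apply: vmeasZ => //; exact: measurable_cst.
rewrite !mulrDr addrA addrA.
apply: (@integral_le_addr_cst R _ _ (unif01 R) _
  (fun q => enorm (A0 + b q) `^ p + 6 * (gamma * sigma_h) `^ p) _ _ _ _ _ _ th2).
- by rewrite mulr_ge0 ?powR_ge0.
- apply: measurable_funD; last exact: measurable_cst.
  apply/measurable_EFinP; apply: measurable_enorm_powR.
  by apply: vmeasD => //; exact: vmeas_cst.
- by move=> q; rewrite addr_ge0 ?mulr_ge0 ?powR_ge0.
- by move=> q; apply: integral_ge0 => zh _; apply: integral_ge0 => z _; rewrite lee_fin powR_ge0.
apply: (@integral_le_addr_cst R _ _ (unif01 R) _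
  (fun q => enorm (A0 + b q) `^ p)).
- by rewrite mulr_ge0 ?powR_ge0.
- apply/measurable_EFinP; apply: measurable_enorm_powR.
  by apply: vmeasD => //; exact: vmeas_cst.
- by move=> q; exact: powR_ge0.
- by move=> q; rewrite lee_fin addr_ge0 ?mulr_ge0 ?powR_ge0.
- by [].
rewrite -(powR_enormZ p _ a1') -/A0; apply: integral_enormD_powR => //.
  move=> i; under eq_integral do rewrite mxE EFinM.
  rewrite integralZl//.
    by rewrite (integral_hessian_line F_smooth xp v i dG L0) mule0.
  apply: le_integrable (finite_measure_integrable_cst _ (2 * L * gamma) (@measurableT _ _)) => //.
    by apply/measurable_EFinP; exact: b1_meas.
  move=> q _; rewrite lee_fin (le_trans (coord_le_enorm _ i))//.
  by rewrite (le_trans (b1_le q))// ler_norm.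
apply: (@le_trans _ _ (\int[unif01 R]_q ((2 * L * gamma) `^ p)%:E)%E); last first.
  by rewrite integral_cst_probability.
apply: ge0_le_integral_dom => q; first by rewrite lee_fin powR_ge0.
rewrite lee_fin ge0_ler_powR ?nnegrE ?enorm_ge0// ?mulr_ge0 ?(ltW gamma0)//.
rewrite enormZ ger0_norm// (le_trans _ (b1_le q))// ler_piMl ?enorm_ge0//.
by rewrite lerBlDr lerDl.
Qed.

End oracles.

(** * The run of the algorithm *)

Section three_independent_samples.
Context (R : realType) (dO dS d1 d2 d3 : measure_display).
Context (Omega : measurableType dO) (S : measurableType dS) (E1 : measurableType d1)
  (E2 : measurableType d2) (E3 : measurableType d3).
Context (P : probability Omega R) (I : eqType) (G : I -> set (set Omega)).
Context (J : set I) (Y : Omega -> S) (j1 j2 j3 : I)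
  (Z1 : {RV P >-> E1}) (Z2 : {RV P >-> E2}) (Z3 : {RV P >-> E3}).
Hypotheses (mG : forall i, G i `<=` measurable) (Yind : indep_of P G J Y).
Hypotheses (Jj1 : J j1) (Jj2 : (J `\ j1) j2) (Jj3 : (J `\ j1 `\ j2) j3).
Hypotheses (Gj1 : G j1 = preimage_set_system setT Z1 measurable)
  (Gj2 : G j2 = preimage_set_system setT Z2 measurable)
  (Gj3 : G j3 = preimage_set_system setT Z3 measurable).

Lemma indep_of_pair3 :
  indep_of P G (J `\ j1 `\ j2 `\ j3) (fun w => (Y w, Z1 w, Z2 w, Z3 w)).
Proof.
exact: (indep_of_pair mG (indep_of_pair mG (indep_of_pair mG Yind Jj1 Gj1) Jj2 Gj2)
  Jj3 Gj3).
Qed.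

(** The samples are integrated out in the reverse of the order in which they were adjoined, which
    produces the nesting of integrals in [moment_step]. *)
Lemma ge0_integral_indep3 (Q1 : probability E1 R) (Q2 : probability E2 R)
    (Q3 : probability E3 R) (phi : (S * E1 * E2 * E3)%type -> \bar R) :
  has_law Z1 Q1 -> has_law Z2 Q2 -> has_law Z3 Q3 ->
  measurable_fun setT phi -> (forall z, 0 <= phi z)%E ->
  (\int[P]_w phi (Y w, Z1 w, Z2 w, Z3 w) =
   \int[P]_w \int[Q1]_z1 \int[Q2]_z2 \int[Q3]_z3 phi (Y w, z1, z2, z3))%E.
Proof.
move=> l1 l2 l3 mphi phi0.
have Y1 := indep_of_pair mG Yind Jj1 Gj1.
have Y2 := indep_of_pair mG Y1 Jj2 Gj2.
rewrite (ge0_integral_indep Y2 Jj3 Gj3 l3 mphi phi0).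
pose phi2 := fubini_F Q3 phi.
have mphi2 : measurable_fun setT phi2 by exact: measurable_fun_fubini_tonelli_F.
have phi20 z : (0 <= phi2 z)%E by exact: integral_ge0.
rewrite (ge0_integral_indep Y1 Jj2 Gj2 l2 mphi2 phi20).
pose phi1 := fubini_F Q2 phi2.
have mphi1 : measurable_fun setT phi1 by exact: measurable_fun_fubini_tonelli_F.
have phi10 z : (0 <= phi1 z)%E by exact: integral_ge0.
exact: (ge0_integral_indep Yind Jj1 Gj1 l1 mphi1 phi10).
Qed.

End three_independent_samples.

Section process.
Context (R : realType) (p : R).
Hypothesis p12 : 1 < p <= 2.
Context (d : nat) (dX : measure_display) (Xi : measurableType dX).
Context (D : probability Xi R) (F : 'rV[R]_d -> R).
Context (gf : 'rV[R]_d -> Xi -> 'rV[R]_d) (Hf : 'rV[R]_d -> Xi -> 'M[R]_d).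
Context (L sigma sigma_h : R).
Hypotheses (L0 : 0 <= L) (F_smooth : smooth L F)
  (F_diff2 : twice_differentiable F).
Hypotheses (sigma0 : 0 < sigma) (gfP : grad_pBCM D p sigma F gf).
Hypotheses (sigma_h0 : 0 < sigma_h) (HfP : hess_pBCM D p sigma_h F Hf).
Context (dO : measure_display) (Omega : measurableType dO) (P : probability Omega R).
Context (xi0 xi xih : nat -> {RV P >-> Xi}) (q : nat -> {RV P >-> R}).
Hypothesis sampling : valid_sampling D xi0 xi xih q.
Let G := sample_sigma xi0 xi xih q.

Lemma sample_sigma_sub s : G s `<=` measurable.
Proof.
by case: s => n A [B mB <-]; rewrite setTI -[X in measurable X]setTI;
  exact: measurable_funP.
Qed.

(** * The initial batch as a sum of independent centered increments *)

Section batch.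
Context (x0 : 'rV[R]_d) (B : nat).
Hypothesis B0 : (0 < B)%N.

(** The weight is the inverse of the final size [B] for every k, so passing from k to k+1 only adds
    one centered increment. *)
Definition batch_error (k : nat) (w : Omega) : 'rV[R]_d :=
  \sum_(j < k) B%:R^-1 *: (gf x0 (xi0 j w) - grad F x0).

Lemma batch_meanE w :
  batch_mean gf x0 B (fun j => xi0 j w) = grad F x0 + batch_error B w.
Proof.
rewrite /batch_mean /batch_error -scaler_sumr sumrB scalerBr.
rewrite sumr_const card_ord -[grad F x0 *+ B]scaler_nat scalerA mulVf ?pnatr_eq0 -?lt0n//.
by rewrite scale1r addrCA subrr addr0.
Qed.

(** The k-th partial sum has used the initial samples below k only, so sample k is still fresh for
    the next increment. *)
Lemma batch_error_indep k :
  indep_of P G [set s | if s is InitSample j then (k <= j)%N else true]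
    (fun w => tuple_of_vec (batch_error k w)).
Proof.
have [_ _ Pind] := sampling.
elim: k => [|k ih].
  have -> : (fun w => tuple_of_vec (batch_error 0 w)) =
      (fun=> tuple_of_vec 0) :> (Omega -> d.-tuple R).
    by apply/funext => w; rewrite /batch_error big_ord0.
  exact: indep_of_cst.
have Gk : G (InitSample k) = preimage_set_system setT (xi0 k) measurable by [].
have := indep_of_pair (j := InitSample k) sample_sigma_sub ih (leqnn k) Gk.
pose phi (y : d.-tuple R * Xi) : d.-tuple R :=
  tuple_of_vec (vec_of_tuple y.1 + B%:R^-1 *: (gf x0 y.2 - grad F x0)).
have mphi : measurable_fun [set: (d.-tuple R * Xi)%type] phi.
  apply: measurable_tuple_of_vec; apply: vmeasD.
    exact: vmeas_vec_of_tuple measurable_fst.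
  apply: vmeasZ; first exact: measurable_cst.
  apply: vmeasB; last exact: vmeas_cst.
  move=> i; have [mg _] := gfP.
  exact: (jointly_measurable_comp (mg i) (vmeas_cst x0) measurable_snd).
move=> /(indep_of_comp mphi) ind.
have -> : (fun w => tuple_of_vec (batch_error k.+1 w)) =
    (phi \o (fun w => (tuple_of_vec (batch_error k w), xi0 k w))).
  apply/funext => w; rewrite /phi /= tuple_of_vecK.
  by rewrite /batch_error big_ord_recr.
apply: indep_of_sub ind => -[] n /= kn; split=> //; first exact: ltnW.
by case=> nk; rewrite nk ltnn in kn.
Qed.

Lemma vmeas_batch_error k : vmeas (batch_error k).
Proof.
have [mY _] := batch_error_indep k => i.
by apply: eq_measurable_fun (vmeas_vec_of_tuple mY i) => w _ /=; rewrite tuple_of_vecK.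
Qed.

Lemma batch_error_moment k :
  (\int[P]_w (enorm (batch_error k w) `^ p)%:E <=
   (k%:R * (6 * (B%:R^-1 * sigma) `^ p))%:E)%E.
Proof.
have p0 : 0 < p by have /andP[? ?] := p12; lra.
elim: k => [|k ih].
  rewrite mul0r integral0_eq// => w _.
  by rewrite /batch_error big_ord0 enorm0 powR0// gt_eqF.
pose phi (y : d.-tuple R * Xi) : \bar R :=
  (enorm (vec_of_tuple y.1 + B%:R^-1 *: (gf x0 y.2 - grad F x0)) `^ p)%:E.
have mphi : measurable_fun [set: (d.-tuple R * Xi)%type] phi.
  apply: measurable_enorm_powR; apply: vmeasD.
    exact: vmeas_vec_of_tuple measurable_fst.
  apply: vmeasZ; first exact: measurable_cst.
  apply: vmeasB; last exact: vmeas_cst.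
  move=> i; have [mg _] := gfP.
  exact: (jointly_measurable_comp (mg i) (vmeas_cst x0) measurable_snd).
have phi0 z : (0 <= phi z)%E by rewrite lee_fin powR_ge0.
have [law _ _] := sampling; have [law0 _ _] := law k.
have := ge0_integral_indep (j := InitSample k) (batch_error_indep k) (leqnn k)
  erefl law0 mphi phi0.
rewrite (eq_integral (fun w => (enorm (batch_error k.+1 w) `^ p)%:E)); last first.
  by move=> w _; rewrite /phi /= tuple_of_vecK /batch_error big_ord_recr.
move=> ->; rewrite -natr1 mulrDl mul1r.
apply: (integral_le_addr_cst _ _ _ _ _ ih).
- by rewrite mulr_ge0 ?powR_ge0.
- by apply/measurable_EFinP; apply: measurable_enorm_powR; exact: vmeas_batch_error.
- by move=> w; exact: powR_ge0.
- by move=> w; apply: integral_ge0 => z _; exact: phi0.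
- move=> w; rewrite /phi /= tuple_of_vecK.
  apply: integral_enormD_powR => //.
  + exact: (vmeas_grad_noise gfP).
  + by move=> i; apply: (integral_grad_noise p12 gfP).
  + by apply: (grad_noise_moment sigma0 gfP); rewrite invr_ge0.
Qed.

End batch.

(** * The iterates as a Markov chain, and the bounds along it *)

Section run.
Context (x0 : 'rV[R]_d) (B : nat) (alpha gamma u0 : R).
Hypotheses (B0 : (0 < B)%N) (alpha01 : 0 < alpha <= 1) (gamma0 : 0 < gamma).
Hypothesis u0_ge0 : 0 <= u0.
Hypothesis u0P : B%:R * (6 * (B%:R^-1 * sigma) `^ p) <= u0 `^ p.

Definition run_state (t : nat) (w : Omega) : 'rV[R]_d * 'rV[R]_d * 'rV[R]_d :=
  nsgdhess gf Hf gamma alpha x0 (batch_mean gf x0 B (fun j => xi0 j w))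
    (fun s => q s w) (fun s => xi s w) (fun s => xih s w) t.

Let S := (d.-tuple R * d.-tuple R * d.-tuple R)%type.

Definition state_code (s : 'rV[R]_d * 'rV[R]_d * 'rV[R]_d) : S :=
  (tuple_of_vec s.1.1, tuple_of_vec s.1.2, tuple_of_vec s.2).

(** State t has consumed the indices 1 to t, since [nsgdhess] reads index t+1 when passing to state
    t+1. All initial samples count as spent. *)
Definition future (t : nat) : set sample := [set s |
  match s with
  | InitSample _ => False
  | UnifSample k | GradSample k | HessSample k => (t < k)%N
  end].

Definition sample_next_g (y : S * R * Xi * Xi) : 'rV[R]_d :=
  next_g gf Hf alpha (vec_of_tuple y.1.1.1.1.1) (vec_of_tuple y.1.1.1.1.2)
    (vec_of_tuple y.1.1.1.2) y.1.1.2 y.1.2 y.2.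

Definition sample_step (y : S * R * Xi * Xi) : S :=
  let x := vec_of_tuple y.1.1.1.1.2 in
  let g := sample_next_g y in
  state_code (x, x - gamma *: normalize g, g).

Lemma measurable_state_code (dT : measure_display) (T : measurableType dT)
    (a b c : T -> 'rV[R]_d) : vmeas a -> vmeas b -> vmeas c ->
  measurable_fun setT (fun z => state_code (a z, b z, c z)).
Proof.
move=> ma mb mc; apply: measurable_fun_pair; first apply: measurable_fun_pair;
  exact: measurable_tuple_of_vec.
Qed.

Let mS : measurable_fun setT (fun y : (S * R * Xi * Xi)%type => y.1.1.1).
Proof. by do 3 apply: measurableT_comp => //. Qed.

Let mq : measurable_fun setT (fun y : (S * R * Xi * Xi)%type => y.1.1.2).
Proof. by do 3 apply: measurableT_comp => //. Qed.

Let mzh : measurable_fun setT (fun y : (S * R * Xi * Xi)%type => y.1.2).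
Proof. by do 2 apply: measurableT_comp => //. Qed.

Let mxp : vmeas (fun y : (S * R * Xi * Xi)%type => vec_of_tuple y.1.1.1.1.1).
Proof. by apply: vmeas_vec_of_tuple; do 2 apply: measurableT_comp => //. Qed.

Let mx : vmeas (fun y : (S * R * Xi * Xi)%type => vec_of_tuple y.1.1.1.1.2).
Proof. by apply: vmeas_vec_of_tuple; do 2 apply: measurableT_comp => //. Qed.

Let mg : vmeas (fun y : (S * R * Xi * Xi)%type => vec_of_tuple y.1.1.1.2).
Proof. by apply: vmeas_vec_of_tuple; do 1 apply: measurableT_comp => //. Qed.

Lemma vmeas_sample_next_g : vmeas sample_next_g.
Proof.
apply: vmeasD; apply: vmeasZ; try exact: measurable_cst.
  apply: vmeasD => //; apply: vmeas_mulmx; first exact: vmeasB.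
  move=> i j; have [mH _] := HfP.
  apply: (jointly_measurable_comp (mH i j)) => //.
  apply: vmeasD; apply: vmeasZ => //.
  by apply: measurable_funB => //; exact: measurable_cst.
move=> i; have [mgf _] := gfP.
exact: (jointly_measurable_comp (mgf i) mx measurable_snd).
Qed.

Lemma measurable_sample_step : measurable_fun setT sample_step.
Proof.
apply: measurable_state_code => //; last exact: vmeas_sample_next_g.
apply: vmeasB => //; apply: vmeasZ; first exact: measurable_cst.
by apply: vmeas_normalize; exact: vmeas_sample_next_g.
Qed.

Lemma vmeas_grad (dT : measure_display) (T : measurableType dT) (x : T -> 'rV[R]_d) :
  vmeas x -> vmeas (fun z => grad F (x z)).
Proof.
move=> mx' i; have [mgf EM] := gfP.
apply: (measurable_expectation_param (m := fun x => grad F x 0 i) (mgf i) _ mx').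
by move=> y; have [Ey _] := EM y.
Qed.

Lemma run_state_step t w : state_code (run_state t.+1 w) =
  sample_step (state_code (run_state t w), q t.+1 w, xih t.+1 w, xi t.+1 w).
Proof.
rewrite /sample_step /sample_next_g /run_state /=.
by case: (nsgdhess _ _ _ _ _ _ _ _ _ t) => [[a b] c] /=; rewrite !tuple_of_vecK.
Qed.

Lemma run_state_indep t : indep_of P G (future t) (fun w => state_code (run_state t w)).
Proof.
elim: t => [|t ih].
  pose phi (u : d.-tuple R) : S := let g0 := grad F x0 + vec_of_tuple u in
    state_code (x0, x0 - gamma *: normalize g0, g0).
  have mphi : measurable_fun setT phi.
    have mg0 : vmeas (fun u : d.-tuple R => grad F x0 + vec_of_tuple u).
      apply: vmeasD; first exact: vmeas_cst.
      exact: vmeas_vec_of_tuple (@measurable_id _ _ setT).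
    apply: measurable_state_code => //.
    apply: vmeasB; first exact: vmeas_cst.
    by apply: vmeasZ; [exact: measurable_cst|exact: vmeas_normalize].
  have -> : (fun w => state_code (run_state 0 w)) =
      phi \o (fun w => tuple_of_vec (batch_error x0 B B w)).
    by apply/funext => w; rewrite /phi /= tuple_of_vecK -batch_meanE.
  apply: indep_of_sub (indep_of_comp mphi (batch_error_indep x0 B B)).
  by case.
have := @indep_of_pair3 _ _ _ _ _ _ _ _ _ _ _ P _ G _ _ (UnifSample t.+1) (HessSample t.+1)
  (GradSample t.+1) (q t.+1) (xih t.+1) (xi t.+1) sample_sigma_sub ih.
have Ju : future t (UnifSample t.+1) by exact: ltnSn.
have Jh : (future t `\ UnifSample t.+1) (HessSample t.+1) by split; first exact: ltnSn.
have Jg : (future t `\ UnifSample t.+1 `\ HessSample t.+1) (GradSample t.+1).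
  by split; first split; first exact: ltnSn.
move=> /(_ Ju Jh Jg erefl erefl erefl) /(indep_of_comp measurable_sample_step) ind.
have -> : (fun w => state_code (run_state t.+1 w)) = sample_step \o
    (fun w => (state_code (run_state t w), q t.+1 w, xih t.+1 w, xi t.+1 w)).
  by apply/funext => w; rewrite run_state_step.
apply: indep_of_sub ind => -[] k //= tk; split; try split; try split; try exact: ltnW;
  by [|case=> kt; rewrite kt ltnn in tk].
Qed.

Lemma vmeas_run_state t :
  [/\ vmeas (fun w => (run_state t w).1.1), vmeas (fun w => (run_state t w).1.2) &
      vmeas (fun w => (run_state t w).2)].
Proof.
have [mY _] := run_state_indep t.
have E (u : 'rV[R]_d) : vec_of_tuple (tuple_of_vec u) = u := tuple_of_vecK u.
split=> i.
- have := vmeas_vec_of_tuple (measurableT_comp measurable_fst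
    (measurableT_comp measurable_fst mY)) i.
  by apply: eq_measurable_fun => w _ /=; rewrite E.
- have := vmeas_vec_of_tuple (measurableT_comp measurable_snd
    (measurableT_comp measurable_fst mY)) i.
  by apply: eq_measurable_fun => w _ /=; rewrite E.
- have := vmeas_vec_of_tuple (measurableT_comp measurable_snd mY) i.
  by apply: eq_measurable_fun => w _ /=; rewrite E.
Qed.

Lemma run_state_displacement t w :
  enorm ((run_state t w).1.2 - (run_state t w).1.1) <= gamma.
Proof.
have h (x g : 'rV[R]_d) : enorm (x - gamma *: normalize g - x) <= gamma.
  rewrite addrAC subrr sub0r enormN enormZ gtr0_norm// ler_piMr ?(ltW gamma0)//.
  exact: enorm_normalize_le1.
case: t => [|t]; first exact: h.
by rewrite /run_state /=; case: (nsgdhess _ _ _ _ _ _ _ _ _ t) => [[a b] c] /=.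
Qed.

Definition run_error (t : nat) (w : Omega) : 'rV[R]_d :=
  (run_state t w).2 - grad F (run_state t w).1.1.

Lemma vmeas_run_error t : vmeas (run_error t).
Proof.
have [m1 _ m2] := vmeas_run_state t.
by apply: vmeasB => //; exact: vmeas_grad.
Qed.

Definition noise_level : R :=
  6 * ((2 * L * gamma) `^ p + (gamma * sigma_h) `^ p + (alpha * sigma) `^ p).

Lemma run_error_moment_step t :
  (\int[P]_w (enorm (run_error t.+1 w) `^ p)%:E <=
   \int[P]_w ((1 - alpha) `^ p * enorm (run_error t w) `^ p + noise_level)%:E)%E.
Proof.
have [a0 a1] := andP alpha01.
pose phi (y : S * R * Xi * Xi) : \bar R :=
  (enorm (sample_next_g y - grad F (vec_of_tuple y.1.1.1.1.2)) `^ p)%:E.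
have mphi : measurable_fun setT phi.
  apply: measurable_enorm_powR; apply: vmeasB; first exact: vmeas_sample_next_g.
  exact: vmeas_grad.
have phi0 z : (0 <= phi z)%E by rewrite lee_fin powR_ge0.
have [law lawq _] := sampling; have [_ lawx lawxh] := law t.+1.
have lawU : has_law (q t.+1) (unif01 R) by move=> A mA; rewrite lawq.
have Ju : future t (UnifSample t.+1) by exact: ltnSn.
have Jh : (future t `\ UnifSample t.+1) (HessSample t.+1) by split; first exact: ltnSn.
have Jg : (future t `\ UnifSample t.+1 `\ HessSample t.+1) (GradSample t.+1).
  by split; first split; first exact: ltnSn.
have phiE w : (enorm (run_error t.+1 w) `^ p)%:E =
    phi (state_code (run_state t w), q t.+1 w, xih t.+1 w, xi t.+1 w).
  rewrite /phi /run_error /sample_next_g /run_state /=.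
  by case: (nsgdhess _ _ _ _ _ _ _ _ _ t) => [[a b] c] /=; rewrite !tuple_of_vecK.
have intE := @ge0_integral_indep3 _ _ _ _ _ _ _ _ _ _ _ P _ G _ _ (UnifSample t.+1)
  (HessSample t.+1) (GradSample t.+1) (q t.+1) (xih t.+1) (xi t.+1) sample_sigma_sub
  (run_state_indep t) Ju Jh Jg erefl erefl erefl (unif01 R) D D phi
  lawU lawxh lawx mphi phi0.
apply: (@le_trans _ _ (\int[P]_w
    phi (state_code (run_state t w), q t.+1 w, xih t.+1 w, xi t.+1 w))%E).
  by rewrite le_eqVlt; apply/orP; left; apply/eqP/eq_integral => w _; exact: phiE.
rewrite intE; apply: ge0_le_integral_dom => w.
  by do 3 (apply: integral_ge0 => ? _); exact: phi0.
rewrite /phi /sample_next_g /= !tuple_of_vecK.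
apply: (moment_step p12 L0 F_smooth F_diff2 sigma0 gfP sigma_h0 HfP).
- by rewrite (ltW a0) a1.
- exact: gamma0.
- exact: run_state_displacement.
Qed.

(** As (1-alpha)^p <= 1-alpha, the level V/alpha with V = [noise_level] is preserved by the
    recursion: (1-alpha) V/alpha + V = V/alpha. The initial part keeps its own decay, so that its
    sum over t costs 1/alpha instead of T. *)
Lemma run_error_moment t :
  (\int[P]_w (enorm (run_error t w) `^ p)%:E <=
   (((1 - alpha) ^+ t * u0) `^ p + noise_level / alpha)%:E)%E.
Proof.
have [a0 a1] := andP alpha01; have /andP[p1 _] := p12.
have a1' : 0 <= 1 - alpha by rewrite subr_ge0.
have V0 : 0 <= noise_level by rewrite mulr_ge0 ?addr_ge0 ?powR_ge0.
elim: t => [|t ih].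
  rewrite expr0 mul1r (@le_trans _ _ (u0 `^ p)%:E)//; last first.
    by rewrite lee_fin lerDl divr_ge0 ?(ltW a0).
  apply: (@le_trans _ _ (B%:R * (6 * (B%:R^-1 * sigma) `^ p))%:E); last by rewrite lee_fin.
  apply: le_trans (batch_error_moment x0 B B); rewrite le_eqVlt; apply/orP; left.
  apply/eqP; apply: eq_integral => w _.
  by rewrite /run_error /run_state /= batch_meanE// addrAC subrr add0r.
apply: (le_trans (run_error_moment_step t)).
under eq_integral do rewrite EFinD EFinM.
have me : measurable_fun setT (fun w => (enorm (run_error t w) `^ p)%:E).
  exact: measurable_enorm_powR (vmeas_run_error t).
rewrite ge0_integralD//; last 2 first.
- by move=> w _; rewrite -EFinM lee_fin mulr_ge0 ?powR_ge0.
- exact: measurable_funeM.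
rewrite integral_cst_probability ge0_integralZl//; last 2 first.
- by move=> w _; rewrite lee_fin powR_ge0.
- by rewrite lee_fin powR_ge0.
apply: (@le_trans _ _ (((1 - alpha) `^ p)%:E *
    (((1 - alpha) ^+ t * u0) `^ p + noise_level / alpha)%:E + noise_level%:E)%E).
  by rewrite leeD2r// lee_wpmul2l// lee_fin powR_ge0.
rewrite -EFinM -EFinD lee_fin mulrDr -powRM ?mulr_ge0 ?exprn_ge0// mulrA -exprS.
rewrite -addrA lerD2l.
have h : (1 - alpha) `^ p <= 1 - alpha.
  have [->|an] := eqVneq (1 - alpha) 0; first by rewrite powR0 ?gt_eqF// (lt_trans ltr01).
  by apply: ge1r_powR (ltW p1); rewrite lt_neqAle eq_sym an a1' lerBlDr lerDl ltW.
apply: (@le_trans _ _ ((1 - alpha) * (noise_level / alpha) + noise_level)).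
  by rewrite lerD2r ler_wpM2r// divr_ge0 ?(ltW a0).
rewrite le_eqVlt; apply/orP; left; apply/eqP; field; lra.
Qed.

Lemma run_state_next t w :
  (run_state t w).1.2 = (run_state t w).1.1 - gamma *: normalize (run_state t w).2 /\
  (run_state t.+1 w).1.1 = (run_state t w).1.2.
Proof.
case: t => [|t] //; rewrite /run_state /=.
by case: (nsgdhess _ _ _ _ _ _ _ _ _ t) => [[a b] c].
Qed.

(** With e = g - grad F x and n the normalized g, <grad F x, n> >= |g| - |e| while |grad F x| <= |g|
    + |e|; hence the factor 2 on the error. The convention n = 0 for g = 0 respects both bounds. *)
Lemma run_descent t w :
  gamma * enorm (grad F (run_state t w).1.1) <=
  F (run_state t w).1.1 - F (run_state t.+1 w).1.1 +
  (2 * gamma * enorm (run_error t w) + L * gamma ^+ 2 / 2).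
Proof.
have [xE ->] := run_state_next t w.
have := run_state_displacement t w; rewrite xE /run_error.
set x := (run_state t w).1.1; set g := (run_state t w).2.
have := smooth_le F_smooth x (x - gamma *: normalize g).
have -> : x - gamma *: normalize g - x = - (gamma *: normalize g).
  by rewrite addrAC subrr sub0r.
rewrite edotNr edotZr enormN => h1 h2.
have h3 : L / 2 * enorm (gamma *: normalize g) ^+ 2 <= L * gamma ^+ 2 / 2.
  rewrite [leRHS]mulrAC ler_wpM2l ?divr_ge0//.
  by rewrite ler_pXn2r ?nnegrE ?enorm_ge0 ?(ltW gamma0).
have e1 : edot (grad F x) (normalize g) >= enorm g - enorm (g - grad F x).
  rewrite -edot_normalize -[X in edot X _ - _](subrK (grad F x)) edotDl.
  rewrite lerBlDr addrC lerD2l (le_trans (edot_le _ _))//.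
  by rewrite ler_piMr ?enorm_ge0// enorm_normalize_le1.
have e2 : enorm (grad F x) <= enorm g + enorm (g - grad F x).
  by rewrite -[X in enorm X <= _](subKr g); exact: enormB.
have e3 : gamma * enorm (grad F x) <=
    gamma * (edot (grad F x) (normalize g) + 2 * enorm (g - grad F x)).
  by rewrite ler_pM2l//; lra.
lra.
Qed.

Lemma run_descent_sum (Fstar : R) (T : nat) w : (forall x, Fstar <= F x) ->
  \sum_(0 <= t < T) enorm (grad F (run_state t w).1.1) <=
  (F x0 - Fstar) / gamma + T%:R * (L * gamma / 2) +
  2 * \sum_(0 <= t < T) enorm (run_error t w).
Proof.
move=> Fs; rewrite -(ler_pM2l gamma0).
have h : gamma * \sum_(0 <= t < T) enorm (grad F (run_state t w).1.1) <=
    F x0 - F (run_state T w).1.1 +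
    (2 * gamma * \sum_(0 <= t < T) enorm (run_error t w) + T%:R * (L * gamma ^+ 2 / 2)).
  elim: T => [|T ih]; first by rewrite !big_geq// !mulr0 mul0r subrr !addr0.
  have E (f : nat -> R) : \sum_(0 <= t < T.+1) f t = \sum_(0 <= t < T) f t + f T.
    by rewrite big_nat_recr.
  rewrite !E -[T.+1%:R]natr1; have := run_descent T w; lra.
apply: (le_trans h); have := Fs (run_state T w).1.1.
have -> : gamma * ((F x0 - Fstar) / gamma + T%:R * (L * gamma / 2) +
    2 * \sum_(0 <= t < T) enorm (run_error t w)) =
  F x0 - Fstar + (2 * gamma * \sum_(0 <= t < T) enorm (run_error t w) +
   T%:R * (L * gamma ^+ 2 / 2)) by field; rewrite gt_eqF.
lra.
Qed.

(** Chosen so that its p-th power dominates [noise_level / alpha]: superadditivity merges the three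
    powers, and 6 <= 6^p lets the 6 move inside. *)
Definition noise_radius : R :=
  6 * (2 * L * gamma + gamma * sigma_h + alpha * sigma) / alpha `^ p^-1.

Lemma noise_radius_gt0 : 0 < noise_radius.
Proof.
have [a0 _] := andP alpha01.
rewrite divr_gt0 ?powR_gt0// mulr_gt0// ltr_wpDl ?mulr_gt0//.
by rewrite addr_ge0 ?mulr_ge0 ?(ltW gamma0) ?(ltW sigma_h0).
Qed.

Lemma noise_levelE : noise_level / alpha <= noise_radius `^ p.
Proof.
have [a0 _] := andP alpha01; have /andP[p1 _] := p12.
have p0 : 0 < p by lra.
have [g0 s0 sh0] : [/\ 0 <= gamma, 0 <= sigma & 0 <= sigma_h] by split; exact: ltW.
have A0 : 0 <= 2 * L * gamma by rewrite !mulr_ge0.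
have B0' : 0 <= gamma * sigma_h by rewrite mulr_ge0.
have C0 : 0 <= alpha * sigma by rewrite mulr_ge0 ?(ltW a0).
rewrite /noise_radius powRM ?invr_ge0 ?powR_ge0 ?mulr_ge0 ?addr_ge0//.
rewrite -[(alpha `^ _)^-1]powRN -powRrM mulNr mulVf ?gt_eqF// powR_inv1 ?(ltW a0)//.
rewrite ler_pM2r ?invr_gt0// powRM ?addr_ge0// /noise_level ler_pM ?addr_ge0 ?powR_ge0//.
  by rewrite -{1}(powRr1 (_ : 0 <= 6 :> R))// ler_powR ?ler1n// ltW.
apply: le_trans (powR_superadd _ _ (ltW p1)); rewrite ?addr_ge0// lerD2r.
exact: powR_superadd (ltW p1).
Qed.

Lemma run_error_mean t :
  (\int[P]_w (enorm (run_error t w))%:E <=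
   (2 * ((1 - alpha) ^+ t * u0 + noise_radius))%:E)%E.
Proof.
have [a0 a1] := andP alpha01; have /andP[p1 _] := p12.
set c := _ + noise_radius.
have d0 : 0 <= (1 - alpha) ^+ t * u0 by rewrite mulr_ge0 ?exprn_ge0 ?subr_ge0.
have c0 : 0 < c by rewrite ltr_wpDl ?noise_radius_gt0.
have cM : (\int[P]_w (enorm (run_error t w) `^ p)%:E <= (c `^ p)%:E)%E.
  apply: (le_trans (run_error_moment t)); rewrite lee_fin.
  apply: le_trans (powR_superadd d0 (ltW noise_radius_gt0) (ltW p1)).
  by rewrite lerD2l noise_levelE.
(* Below c the last summand suffices; above c, x = x^p / x^(p-1) and x^(p-1) >= c^(p-1). With a p-th
   moment of at most c^p, the mean is at most 2 c. *)
have pw x : 0 <= x -> x <= c `^ (1 - p) * x `^ p + c.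
  move=> x0'; have [xc|cx] := leP x c.
    by rewrite (le_trans xc)// lerDr mulr_ge0 ?powR_ge0.
  have x_gt0 := lt_trans c0 cx.
  apply: (@le_trans _ _ (c `^ (1 - p) * x `^ p)); last by rewrite lerDl ltW.
  have -> : 1 - p = - (p - 1) by ring.
  rewrite powRN mulrC ler_pdivlMr ?powR_gt0//.
  rewrite -(mulr_powRB1 x0') ?(lt_trans ltr01)// ler_wpM2l//.
  by rewrite ge0_ler_powR ?nnegrE ?subr_ge0 ?(ltW p1) ?(ltW c0) ?(ltW cx).
have me : measurable_fun setT (fun w => (enorm (run_error t w) `^ p)%:E).
  exact: measurable_enorm_powR (vmeas_run_error t).
have -> : 2 * c = c `^ (1 - p) * c `^ p + c.
  by rewrite -powRD ?(gt_eqF c0) ?implybT// subrK powRr1 ?(ltW c0)//; ring.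
apply: (integral_le_addr_cst (g := fun w => c `^ (1 - p) * enorm (run_error t w) `^ p)).
- exact: ltW.
- by apply: measurable_funM; [exact: measurable_cst|exact/measurable_EFinP].
- by move=> w; rewrite mulr_ge0 ?powR_ge0.
- by move=> w; rewrite lee_fin enorm_ge0.
- by move=> w; rewrite lee_fin pw ?enorm_ge0.
under eq_integral do rewrite EFinM.
rewrite ge0_integralZl//; last 2 first.
- by move=> w _; rewrite lee_fin powR_ge0.
- by rewrite lee_fin powR_ge0.
by rewrite [leRHS]EFinM; apply: lee_wpmul2l; rewrite ?lee_fin ?powR_ge0.
Qed.

Lemma geometric_sum_le (n : nat) : \sum_(0 <= t < n) (1 - alpha) ^+ t <= alpha^-1.
Proof.
have [a0 a1] := andP alpha01.
rewrite -(ler_pM2l a0) mulfV ?gt_eqF//.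
have -> : alpha * \sum_(0 <= t < n) (1 - alpha) ^+ t = 1 - (1 - alpha) ^+ n.
  elim: n => [|n ih]; first by rewrite big_geq// mulr0 expr0 subrr.
  by rewrite big_nat_recr//= mulrDr ih exprS; ring.
by rewrite lerBlDr lerDl exprn_ge0 ?subr_ge0.
Qed.

(** The 4 is the 2 of the descent inequality times the 2 of [run_error_mean]; the geometric series
    turns u0 into u0 / alpha. *)
Lemma run_average (Fstar : R) (T : nat) : (0 < T)%N -> (forall x, Fstar <= F x) ->
  ((T%:R^-1)%:E * \sum_(0 <= t < T) 'E_P[fun w => enorm (grad F (run_state t w).1.1)]
   <= ((F x0 - Fstar) / (gamma * T%:R) + L * gamma / 2 +
       4 * (u0 / (alpha * T%:R) + noise_radius))%:E)%E.
Proof.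
move=> T0 Fs; have [a0 a1] := andP alpha01.
have T0' : 0 < T%:R :> R by rewrite ltr0n.
have me t : measurable_fun setT (fun w => (enorm (run_error t w))%:E).
  by apply/measurable_EFinP; apply: measurable_enorm; exact: vmeas_run_error.
have mgr t : measurable_fun setT (fun w => (enorm (grad F (run_state t w).1.1))%:E).
  apply/measurable_EFinP; apply: measurable_enorm; apply: vmeas_grad.
  by have [] := vmeas_run_state t.
rewrite (eq_bigr (fun t => \int[P]_w (enorm (grad F (run_state t w).1.1))%:E)%E);
  last by move=> t _; rewrite unlock.
rewrite -ge0_integral_sum//; last by move=> t w _; rewrite lee_fin enorm_ge0.
pose K := (F x0 - Fstar) / gamma + T%:R * (L * gamma / 2).
have K0 : 0 <= K.
  by rewrite addr_ge0 ?divr_ge0 ?subr_ge0 ?mulr_ge0 ?divr_ge0 ?mulr_ge0 ?(ltW gamma0).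
have sumM : (\int[P]_w (2 * \sum_(0 <= t < T) enorm (run_error t w))%:E <=
    (4 * (u0 / alpha + T%:R * noise_radius))%:E)%E.
  under eq_integral do rewrite EFinM -sumEFin.
  rewrite ge0_integralZl//; last 2 first.
  - by apply: emeasurable_sum.
  - by move=> w _; apply: sume_ge0 => t _; rewrite lee_fin enorm_ge0.
  rewrite ge0_integral_sum//; last by move=> t w _; rewrite lee_fin enorm_ge0.
  apply: (@le_trans _ _ (2%:E * \sum_(0 <= t < T)
      (2 * ((1 - alpha) ^+ t * u0 + noise_radius))%:E)%E).
    by apply: lee_wpmul2l => //; apply: lee_sum => t _; exact: run_error_mean.
  rewrite sumEFin -EFinM lee_fin -mulr_sumr mulrA -natrM ler_pM2l//.
  have -> : \sum_(0 <= t < T) ((1 - alpha) ^+ t * u0 + noise_radius) =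
      u0 * (\sum_(0 <= t < T) (1 - alpha) ^+ t) + T%:R * noise_radius.
    by rewrite big_split/= -mulr_suml sumr_const_nat subn0 mulr_natl mulrC.
  by rewrite lerD2r ler_wpM2l// geometric_sum_le.
apply: (@le_trans _ _ ((T%:R^-1)%:E *
    (4 * (u0 / alpha + T%:R * noise_radius) + K)%:E)%E).
  apply: lee_wpmul2l; first by rewrite lee_fin invr_ge0.
  apply: (integral_le_addr_cst (g := fun w => 2 * \sum_(0 <= t < T) enorm (run_error t w)) K0).
  - apply: measurable_funM; first exact: measurable_cst.
    by apply: measurable_sum => t; apply: measurable_enorm; exact: vmeas_run_error.
  - by move=> w; rewrite mulr_ge0// sumr_ge0// => t _; exact: enorm_ge0.
  - by move=> w; apply: sume_ge0 => t _; rewrite lee_fin enorm_ge0.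
  - by move=> w; rewrite sumEFin lee_fin addrC; exact: run_descent_sum.
  - exact: sumM.
rewrite -EFinM lee_fin le_eqVlt; apply/orP; left; apply/eqP; rewrite /K; field.
by rewrite !gt_eqF.
Qed.

End run.
End process.

(** * Choice of the parameters *)

Lemma powR_cancel (R : realType) (x a b : R) : 0 <= x -> a * b = 1 ->
  (x `^ a) `^ b = x.
Proof. by move=> x0 ab; rewrite -powRrM ab powRr1. Qed.

Section parameters.
Context (R : realType) (p L sigma sigma_h Delta eps : R).
Hypotheses (p12 : 1 < p <= 2) (L0 : 0 <= L) (sigma0 : 0 < sigma)
  (sigma_h0 : 0 < sigma_h) (Delta0 : 0 <= Delta) (eps0 : 0 < eps).

(** This is (2p-1)/(p-1), in the form that splits r^kappa as r^2 r^(1/(p-1)), the shape of the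
    claimed complexity. *)
Definition kappa : R := 2 + 1 / (p - 1).

(* 86 = 1 + 1 + 4 * (3 + 18) is the sum of the coefficients of [w * sigma] in
   [parameters_bound]. *)
Definition horizon_bound : R :=
  (E_init p sigma (B_init p sigma eps) / sigma +
   Delta * (L + sigma_h) / sigma ^+ 2) * (1 + (86 * (sigma / eps)) `^ kappa).

(** The successor makes the horizon positive, and [T - 1] in [sample_complexity] is then exactly the
    ceiling. *)
Definition horizon : nat := (absz (Num.ceil horizon_bound)).+1.

Let p1 : 0 < p - 1. Proof. by have /andP[? ?] := p12; lra. Qed.
Let p2 : 0 < 2 * p - 1. Proof. by have /andP[? ?] := p12; lra. Qed.
Let p0 : 0 < p. Proof. by have /andP[? ?] := p12; lra. Qed.

Lemma absz_ceil_ge (x : R) : 0 <= x -> x <= (absz (Num.ceil x))%:R.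
Proof.
move=> x0; rewrite (le_trans (ceil_ge x))// natr_absz ger0_norm// ceil_ge0.
by rewrite (lt_le_trans _ x0)// ltrN10.
Qed.

Lemma absz_ceil_le (x : R) : 0 <= x -> (absz (Num.ceil x))%:R <= x + 1.
Proof.
move=> x0; have c0 : 0 <= Num.ceil x.
  by rewrite ceil_ge0 (lt_le_trans _ x0)// ltrN10.
rewrite natr_absz ger0_norm//.
have := ceilB1_lt x; rewrite intrB; lra.
Qed.

Lemma B_init_gt0 : (0 < B_init p sigma eps)%N.
Proof.
have : 1 <= (B_init p sigma eps)%:R :> R.
  apply: le_trans (absz_ceil_ge _); rewrite ?le_max ?lexx ?ler01//.
by rewrite ler1n.
Qed.

Lemma E_init_gt0 : 0 < E_init p sigma (B_init p sigma eps).
Proof.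
by rewrite divr_gt0 ?mulr_gt0 ?powR_gt0// ltr0n B_init_gt0.
Qed.

Lemma horizon_bound_ge0 : 0 <= horizon_bound.
Proof.
rewrite mulr_ge0 ?addr_ge0 ?powR_ge0//.
  by rewrite divr_ge0 ?(ltW E_init_gt0)// ltW.
by rewrite divr_ge0 ?mulr_ge0 ?addr_ge0 ?(ltW sigma0) ?sqr_ge0// ltW.
Qed.

Lemma horizon_ge : horizon_bound <= horizon%:R.
Proof.
rewrite (le_trans (absz_ceil_ge horizon_bound_ge0))// ler_nat /horizon.
exact: leqnSn.
Qed.

Lemma horizon_gt0 : 0 < horizon%:R :> R. Proof. by rewrite ltr0n. Qed.

Lemma B_init_ge : (sigma / eps) `^ (p / (p - 1)) <= (B_init p sigma eps)%:R.
Proof.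
apply: le_trans (absz_ceil_ge _); rewrite !le_max ?lexx ?ler01 ?orbT//.
Qed.

Let alpha := momentum p L sigma sigma_h Delta (B_init p sigma eps) horizon.
Let gamma := stepsize p L sigma_h Delta alpha horizon.

(* With [m] the larger of the two ratios in [alpha_eff], [alpha = m `^ (p / (2 * p - 1))];
   setting [beta = alpha `^ p^-1] and [w = m `^ kappa^-1] turns every power into
   the monomials [alpha = beta * w] and [m = beta * w ^+ 2]. *)
Lemma parameters_monomials : exists beta w : R,
  [/\ 0 < beta <= 1, 0 < w, alpha = beta * w /\ alpha <= 1, alpha `^ p^-1 = beta &
   [/\ E_init p sigma (B_init p sigma eps) <= beta * w ^+ 2 * horizon%:R * sigma,
    Delta * (L + sigma_h) <= beta * w ^+ 2 * horizon%:R * sigma ^+ 2 &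
    86 * (w * sigma) <= eps]].
Proof.
pose a1 := E_init p sigma (B_init p sigma eps) / (horizon%:R * sigma).
pose a2 := Delta * (L + sigma_h) / (horizon%:R * sigma ^+ 2).
have T0 := horizon_gt0.
pose m := Num.max a1 a2.
have a1_gt0 : 0 < a1 by rewrite divr_gt0 ?E_init_gt0// mulr_gt0.
have a2_ge0 : 0 <= a2.
  by rewrite divr_ge0 ?mulr_ge0 ?addr_ge0 ?(ltW sigma0) ?(ltW T0) ?(ltW sigma_h0).
have m0 : 0 < m by rewrite lt_max a1_gt0.
pose K := (86 * (sigma / eps)) `^ kappa.
have K0 : 0 < K by rewrite powR_gt0// mulr_gt0// divr_gt0.
have k0 : 0 < kappa by rewrite addr_gt0// divr_gt0.
(* The summand 1 yields m <= 1, so the cap in [momentum] is inactive; the summand K yields m <= 1/K,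
   which becomes 86 w sigma <= eps after taking the power 1/kappa. *)
have mK : m * (1 + K) <= 1.
  have hT := horizon_ge.
  have Es : 0 <= E_init p sigma (B_init p sigma eps) / sigma.
    by rewrite divr_ge0 ?(ltW E_init_gt0) ?(ltW sigma0).
  have Ms : 0 <= Delta * (L + sigma_h) / sigma ^+ 2.
    by rewrite divr_ge0 ?mulr_ge0 ?addr_ge0 ?(ltW sigma0) ?sqr_ge0 ?(ltW sigma_h0).
  have K1 : 0 <= 1 + K by rewrite addr_ge0 ?(ltW K0).
  rewrite -ler_pdivlMr ?ltr_wpDl// ge_max; apply/andP; split.
    rewrite /a1 ler_pdivrMr ?mulr_gt0// mulrAC mul1r ler_pdivlMr ?ltr_wpDl//.
    rewrite -ler_pdivrMr// mulrAC.
    apply: le_trans hT; rewrite /horizon_bound ler_wpM2r//.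
    by rewrite lerDl.
  rewrite /a2 ler_pdivrMr ?mulr_gt0 ?exprn_gt0// mulrAC mul1r ler_pdivlMr ?ltr_wpDl//.
  rewrite -ler_pdivrMr ?exprn_gt0// mulrAC.
  apply: le_trans hT; rewrite /horizon_bound ler_wpM2r//.
  by rewrite lerDr.
have m1 : m <= 1 by nra.
have mK1 : m <= K^-1 by rewrite -[leRHS]mul1r ler_pdivlMr//; nra.
pose s := p / (2 * p - 1).
have s0 : 0 < s by rewrite divr_gt0.
have alphaE : alpha = m `^ s.
  have mono x y : 0 <= x -> x <= y -> x `^ s <= y `^ s.
    by move=> x0 xy; rewrite ge0_ler_powR ?nnegrE ?(ltW s0) ?(le_trans x0).
  have effE : alpha_eff p L sigma sigma_h Delta (B_init p sigma eps) horizon = m `^ s.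
    rewrite /alpha_eff -/s -/a1 -/a2 /m.
    have [h|h] := leP a1 a2; first by apply/max_idPr; rewrite mono// ltW.
    by apply/max_idPl; rewrite mono// ltW.
  rewrite /alpha /momentum effE; apply/min_idPr.
  by have := mono m 1 (ltW m0) m1; rewrite powR1.
have powm x y : m `^ x * m `^ y = m `^ (x + y).
  by rewrite powRD// (gt_eqF m0) implybT.
exists (m `^ (2 * p - 1)^-1), (m `^ kappa^-1).
have kE : kappa^-1 = (p - 1) / (2 * p - 1).
  by rewrite /kappa; field; rewrite !gt_eqF//; have /andP[? ?] := p12; lra.
have mE : m `^ (2 * p - 1)^-1 * (m `^ kappa^-1) ^+ 2 = m.
  rewrite expr2 !powm -[RHS](powRr1 (ltW m0)); congr (_ `^ _).
  by rewrite kE; field; rewrite gt_eqF.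
have le1 x : 0 < x -> m `^ x <= 1.
  move=> x0; have : m `^ x <= 1 `^ x by rewrite ge0_ler_powR ?nnegrE ?(ltW x0) ?(ltW m0).
  by rewrite powR1.
split.
- by rewrite powR_gt0// le1// invr_gt0.
- exact: powR_gt0.
- split; last by rewrite alphaE le1.
  rewrite powm alphaE; congr (_ `^ _); rewrite kE /s; field.
  by rewrite gt_eqF.
- by rewrite alphaE -powRrM; congr (_ `^ _); rewrite /s; field; rewrite !gt_eqF.
- rewrite mE; split.
  + have : a1 <= m by rewrite le_max lexx.
    by rewrite /a1 ler_pdivrMr ?mulr_gt0// mulrA.
  + have : a2 <= m by rewrite le_max lexx orbT.
    by rewrite /a2 ler_pdivrMr ?mulr_gt0 ?exprn_gt0// mulrA.
  + have : m `^ kappa^-1 <= (K^-1) `^ kappa^-1.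
      by rewrite ge0_ler_powR ?nnegrE ?invr_ge0 ?(ltW k0) ?(ltW m0) ?(ltW K0).
    have -> : (K^-1) `^ kappa^-1 = (86 * (sigma / eps))^-1.
      rewrite /K -powRN -powRrM mulNr mulfV ?gt_eqF// powR_inv1//.
      by rewrite mulr_ge0 ?divr_ge0 ?(ltW sigma0) ?(ltW eps0).
    rewrite invfM invf_div => h.
    have := ler_wpM2r (ltW sigma0) h; rewrite -mulrA divfK ?gt_eqF// => h'.
    by rewrite -ler_pdivlMl.
Qed.

Lemma momentum01 : 0 < alpha <= 1.
Proof.
have [beta [w [/andP[b0 _] w0 [aE a1] _ _]]] := parameters_monomials.
by rewrite a1 andbT aE mulr_gt0.
Qed.

Lemma sqr_stepsize :
  gamma ^+ 2 = Delta * alpha `^ p^-1 / ((L + sigma_h) * horizon%:R).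
Proof.
rewrite sqr_sqrtr// divr_ge0 ?mulr_ge0 ?addr_ge0 ?powR_ge0 ?(ltW sigma_h0)//.
Qed.

Lemma stepsize_gt0 : 0 < Delta -> 0 < gamma.
Proof.
move=> D0; rewrite sqrtr_gt0 divr_gt0 ?mulr_gt0 ?powR_gt0 ?ltr_wpDl//.
by case/andP: momentum01.
Qed.

Lemma parameters_bound : 0 < Delta ->
  Delta / (gamma * horizon%:R) + L * gamma / 2 +
    4 * (3 * E_init p sigma (B_init p sigma eps) / (alpha * horizon%:R) +
         6 * (2 * L * gamma + gamma * sigma_h + alpha * sigma) / alpha `^ p^-1) <= eps.
Proof.
move=> D0; have g0 := stepsize_gt0 D0.
have := sqr_stepsize; have := g0.
have [beta [w [/andP[b0 b1] w0 [aE _] -> [hE hM hw]]]] := parameters_monomials.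
rewrite aE; set g := gamma; move=> _ g2.
have T0 := horizon_gt0; have Ls0 : 0 < L + sigma_h by rewrite ltr_wpDl.
move: hE hM g2; set T : R := horizon%:R; set E := E_init _ _ _; move=> hE hM g2.
have {}g2 : g ^+ 2 * ((L + sigma_h) * T) = Delta * beta.
  by rewrite g2 divfK// gt_eqF// mulr_gt0.
(* Squaring removes the root in the stepsize: with g^2 (L + sigma_h) T = Delta beta, both [q1] and
   [q2] reduce to [hM]. The extra factor beta in [q2] pays for the division by alpha^(1/p) = beta in
   [q4]. *)
have q1 : Delta / (g * T) <= w * sigma.
  rewrite ler_pdivrMr ?mulr_gt0//.
  rewrite -(@ler_pXn2r _ 2) ?nnegrE ?mulr_ge0 ?(ltW g0) ?(ltW D0) ?(ltW w0) ?(ltW sigma0) ?(ltW T0)//.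
  rewrite -(ler_pM2r Ls0).
  have -> : (w * sigma * (g * T)) ^+ 2 * (L + sigma_h) =
    (w * sigma) ^+ 2 * T * (g ^+ 2 * ((L + sigma_h) * T)) by ring.
  rewrite g2.
  have -> : Delta ^+ 2 * (L + sigma_h) = Delta * (Delta * (L + sigma_h)) by ring.
  have -> : (w * sigma) ^+ 2 * T * (Delta * beta) =
    Delta * (beta * w ^+ 2 * T * sigma ^+ 2) by ring.
  by rewrite ler_pM2l.
have q2 : g * (L + sigma_h) <= w * sigma * beta.
  rewrite -(@ler_pXn2r _ 2) ?nnegrE ?mulr_ge0 ?(ltW g0) ?(ltW Ls0) ?(ltW w0) ?(ltW sigma0) ?(ltW b0)//.
  rewrite -(ler_pM2r T0).
  have -> : (g * (L + sigma_h)) ^+ 2 * T = (g ^+ 2 * ((L + sigma_h) * T)) * (L + sigma_h) by ring.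
  rewrite g2.
  have -> : Delta * beta * (L + sigma_h) = beta * (Delta * (L + sigma_h)) by ring.
  have -> : (w * sigma * beta) ^+ 2 * T = beta * (beta * w ^+ 2 * T * sigma ^+ 2) by ring.
  by rewrite ler_pM2l.
have q3 : 3 * E / (beta * w * T) <= 3 * (w * sigma).
  rewrite -mulrA ler_pM2l// ler_pdivrMr ?mulr_gt0//.
  by apply: (le_trans hE); rewrite le_eqVlt; apply/orP; left; apply/eqP; ring.
(* By [q2] the two terms in g are at most 2 beta w sigma together, so the sum is at most 3 beta w
   sigma; 6 times 3 is 18. *)
have q4 : 6 * (2 * L * g + g * sigma_h + beta * w * sigma) / beta <= 18 * (w * sigma).
  rewrite ler_pdivrMr//.
  have : 0 <= g * L by rewrite mulr_ge0 ?(ltW g0).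
  have : 0 <= g * sigma_h by rewrite mulr_ge0 ?(ltW g0) ?(ltW sigma_h0).
  lra.
have q5 : L * g / 2 <= w * sigma.
  have : 0 <= g * L by rewrite mulr_ge0 ?(ltW g0).
  have : 0 <= g * sigma_h by rewrite mulr_ge0 ?(ltW g0) ?(ltW sigma_h0).
  have : w * sigma * beta <= w * sigma.
    by rewrite ler_piMr ?mulr_ge0 ?(ltW w0) ?(ltW sigma0).
  have ws : 0 < w * sigma by rewrite mulr_gt0.
  lra.
lra.
Qed.

(** 3 E_0 equals 6 sigma B^(-(p-1)/p), whose p-th power is 6^p sigma^p B^(1-p), while the left side
    is 6 sigma^p B^(1-p). This is why u0 is taken to be 3 E_0. *)
Lemma batch_moment_E_init :
  (B_init p sigma eps)%:R *
    (6 * ((B_init p sigma eps)%:R^-1 * sigma) `^ p) <=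
  (3 * E_init p sigma (B_init p sigma eps)) `^ p.
Proof.
set B : R := (B_init p sigma eps)%:R.
have B0 : 0 < B by rewrite ltr0n B_init_gt0.
have -> : 3 * E_init p sigma (B_init p sigma eps) = 6 * (sigma * B `^ (- ((p - 1) / p))).
  by rewrite /E_init powRN; ring.
rewrite [leRHS]powRM ?mulr_ge0 ?powR_ge0 ?(ltW sigma0)//.
rewrite [in leRHS]powRM ?powR_ge0 ?(ltW sigma0)// -powRrM.
rewrite powRM ?invr_ge0 ?(ltW B0) ?(ltW sigma0)//.
have -> : - ((p - 1) / p) * p = 1 - p by field; rewrite gt_eqF.
have -> : B^-1 `^ p = B `^ (- p) by rewrite powRN -powR_inv1 ?(ltW B0)// -powRrM mulN1r powRN.
have -> : B * (6 * (B `^ (- p) * sigma `^ p)) = 6 * (sigma `^ p * (B * B `^ (- p))) by ring.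
rewrite -{1}(powRr1 (ltW B0)) -powRD ?(gt_eqF B0) ?implybT//.
rewrite ler_wpM2r ?mulr_ge0 ?powR_ge0//.
have /andP[? _] := p12.
by rewrite -{1}(powRr1 (_ : 0 <= 6 :> R))// ler_powR ?ler1n// ltW.
Qed.

(** Put r = sigma/eps >= 1, h = r^(1/(p-1)), c = 86^kappa. The batch costs at most 2 r h, and B >=
    r^(p/(p-1)) gives E_0/sigma <= 2/r, so [horizon_bound] is at most 4 c r h + 2 c h Delta (L +
    sigma_h)/eps^2. Doubling it and absorbing the rounding by 2 <= 2 r h gives 4 + 8 c. *)
Lemma complexity_bound : eps <= sigma ->
  (sample_complexity (B_init p sigma eps) horizon)%:R <=
  (4 + 8 * 86 `^ kappa) *
    (Delta * (L + sigma_h) / eps ^+ 2 +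
     Delta * (L + sigma_h) / eps ^+ 2 * (sigma / eps) `^ (1 / (p - 1)) +
     sigma / eps * (sigma / eps) `^ (1 / (p - 1))).
Proof.
move=> es; set r := sigma / eps.
have r1 : 1 <= r by rewrite ler_pdivlMr// mul1r.
have r0 : 0 < r := lt_le_trans ltr01 r1.
pose h := r `^ (1 / (p - 1)).
have h1 : 1 <= h by rewrite -(powRr0 r) ler_powR// divr_ge0 ?(ltW p1).
have hE : r `^ (p / (p - 1)) = r * h.
  rewrite /h -{2}(powRr1 (ltW r0)) -powRD ?(gt_eqF r0) ?implybT//; congr (_ `^ _).
  by field; rewrite gt_eqF.
have kE : r `^ kappa = r ^+ 2 * h.
  by rewrite /kappa powRD ?(gt_eqF r0) ?implybT// -powR_mulrn ?(ltW r0).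
have X1 : 1 <= r * h by rewrite -[leLHS]mulr1 ler_pM.
have Ble : (B_init p sigma eps)%:R <= 2 * (r * h).
  apply: le_trans (absz_ceil_le _) _; first by rewrite le_max ler01.
  have : Num.max 1 (Num.max (r `^ (p / (p - 1))) (r `^ (p / (2 * p - 1)))) <= r * h.
    rewrite !ge_max X1 hE lexx /= -hE ler_powR//.
    rewrite ler_pM2l// lef_pV2 ?posrE//.
    by have /andP[? ?] := p12; lra.
  lra.
have Ele : E_init p sigma (B_init p sigma eps) / sigma <= 2 / r.
  have -> : E_init p sigma (B_init p sigma eps) / sigma =
      2 / (B_init p sigma eps)%:R `^ ((p - 1) / p).
    rewrite /E_init; field; rewrite !gt_eqF// powR_gt0// ltr0n.
    exact: B_init_gt0.
  rewrite ler_pM2l// lef_pV2 ?posrE ?powR_gt0 ?ltr0n ?B_init_gt0//.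
  rewrite -[leLHS](@powR_cancel _ r (p / (p - 1)) ((p - 1) / p) (ltW r0)); last first.
    by field; rewrite !gt_eqF.
  rewrite ge0_ler_powR ?nnegrE ?powR_ge0 ?divr_ge0 ?(ltW p1) ?(ltW p0)//.
  exact: B_init_ge.
pose c := (86 : R) `^ kappa.
have k0 : 0 < kappa by rewrite addr_gt0// divr_gt0.
have c1 : 1 <= c by rewrite -(powRr0 86) ler_powR ?ler1n// ltW.
have KE : (86 * r) `^ kappa = c * (r ^+ 2 * h) by rewrite powRM ?(ltW r0)// kE.
have KL : 1 + (86 * r) `^ kappa <= 2 * (c * (r ^+ 2 * h)).
  rewrite KE.
  have : 1 <= c * (r ^+ 2 * h).
    rewrite -[leLHS]mulr1 ler_pM// expr2 -mulrA -[leLHS]mulr1 ler_pM//.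
  lra.
set M := Delta * (L + sigma_h).
have M0 : 0 <= M by rewrite mulr_ge0 ?addr_ge0 ?(ltW sigma_h0).
have HB : horizon_bound <= (2 / r + M / sigma ^+ 2) * (2 * (c * (r ^+ 2 * h))).
  rewrite /horizon_bound ler_pM ?addr_ge0 ?powR_ge0//.
  - by rewrite divr_ge0 ?(ltW E_init_gt0) ?(ltW sigma0).
  - by rewrite divr_ge0 ?(ltW sigma0) ?sqr_ge0.
  - by rewrite lerD2r.
have HE : (2 / r + M / sigma ^+ 2) * (2 * (c * (r ^+ 2 * h))) =
    4 * c * (r * h) + 2 * c * (M / eps ^+ 2 * h).
  by rewrite /r; field; rewrite !gt_eqF.
rewrite HE in HB.
rewrite /sample_complexity /horizon subn1 /= natrD natrM.
have := absz_ceil_le horizon_bound_ge0.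
set n := _%:R; move=> nle.
have Y0 : 0 <= M / eps ^+ 2 by rewrite divr_ge0 ?(ltW sigma0) ?sqr_ge0.
have Yh : 0 <= M / eps ^+ 2 * h by rewrite mulr_ge0 ?powR_ge0.
have cY : 0 <= c * (M / eps ^+ 2) by rewrite mulr_ge0 ?powR_ge0.
have cYh : 0 <= c * (M / eps ^+ 2 * h) by rewrite mulr_ge0 ?powR_ge0.
have cX : 0 <= c * (r * h) by rewrite mulr_ge0 ?powR_ge0// (le_trans ler01).
rewrite -/h -/c.
lra.
Qed.

End parameters.

Lemma nsgdhess_stepsize0 (R : realType) (d : nat) (X : Type)
    (gf : 'rV[R]_d -> X -> 'rV[R]_d) (Hf : 'rV[R]_d -> X -> 'M[R]_d)
    (alpha : R) (x0 g0 : 'rV[R]_d) (q : nat -> R) (xi xih : nat -> X) (t : nat) :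
  (nsgdhess gf Hf 0 alpha x0 g0 q xi xih t).1 = (x0, x0).
Proof.
elim: t => [|t] /=; first by rewrite scale0r subr0.
case: (nsgdhess _ _ _ _ _ _ _ _ _ t) => [[a b] c] /= [-> ->].
by rewrite scale0r subr0.
Qed.

Theorem theorem2 (R : realType) (p : R) (hp1 : 1 < p) (hp2 : p <= 2) :
  exists C : R, 0 < C /\
  forall (d : nat)
    (dX : measure_display) (Xi : measurableType dX) (D : probability Xi R)
    (f : 'rV[R]_d -> Xi -> R) (F : 'rV[R]_d -> R)
    (gf : 'rV[R]_d -> Xi -> 'rV[R]_d) (Hf : 'rV[R]_d -> Xi -> 'M[R]_d)
    (Fstar L sigma sigma_h : R) (x0 : 'rV[R]_d) (eps : R),
  (forall x, D.-integrable setT (EFin \o f x) /\ ('E_D[f x] = (F x)%:E)%E) ->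
  (forall x, Fstar <= F x) ->
  0 <= L -> smooth L F ->
  twice_differentiable F ->
  0 < sigma -> grad_pBCM D p sigma F gf ->
  0 < sigma_h -> hess_pBCM D p sigma_h F Hf ->
  0 < eps ->
  let Delta := F x0 - Fstar in
  let B := B_init p sigma eps in
  exists T : nat, (0 < T)%N /\
    let alpha := momentum p L sigma sigma_h Delta B T in
    let gamma := stepsize p L sigma_h Delta alpha T in
    (forall (dO : measure_display) (Omega : measurableType dO)
       (P : probability Omega R)
       (xi0 xi xih : nat -> {RV P >-> Xi}) (q : nat -> {RV P >-> R}),
      valid_sampling D xi0 xi xih q ->
      let x (t : nat) (w : Omega) : 'rV[R]_d :=
        nsgdhess_x gf Hf gamma alpha x0
          (batch_mean gf x0 B (fun j => xi0 j w))
          (fun s => q s w) (fun s => xi s w) (fun s => xih s w) t in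
      ((T%:R^-1)%:E * \sum_(0 <= t < T) 'E_P[fun w => enorm (grad F (x t w))]
         <= eps%:E)%E) /\
    (eps <= sigma ->
      (sample_complexity B T)%:R <=
        C * (Delta * (L + sigma_h) / eps ^+ 2
             + Delta * (L + sigma_h) / eps ^+ 2
               * (sigma / eps) `^ (1 / (p - 1))
             + sigma / eps * (sigma / eps) `^ (1 / (p - 1)))).
Proof.
exists (4 + 8 * 86 `^ kappa p); split.
  by rewrite ltr_wpDr// mulr_ge0 ?powR_ge0.
move=> d dX Xi D f F gf Hf Fstar L sigma sigma_h x0 eps _ Fs L0 F_smooth F_diff2
  sigma0 gfP sigma_h0 HfP eps0 Delta B.
have p12 : 1 < p <= 2 by rewrite hp1.
have Delta0 : 0 <= Delta by rewrite subr_ge0.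
exists (horizon p L sigma sigma_h Delta eps); split=> //.
move=> alpha gamma; split; last exact: complexity_bound.
move=> dO Omega P xi0 xi xih q sampling; cbv zeta.
have T0 : (0 < horizon p L sigma sigma_h Delta eps)%N by [].
(* Delta = 0 forces a zero stepsize: the iterates stay at x0, which minimizes F, so every gradient
   in the average is 0. *)
have [D0|D_gt0] := eqVneq Delta 0.
  have gamma0 : gamma = 0 by rewrite /gamma /stepsize D0 !mul0r sqrtr0.
  have grad0 : grad F x0 = 0.
    apply: (grad_eq0_of_min F_smooth L0) => y.
    by rewrite (le_trans _ (Fs y))// -subr_le0 -/Delta D0.
  rewrite big1 ?mule0 ?lee_fin ?(ltW eps0)// => t _.
  rewrite unlock integral0_eq// => w _.
  by rewrite /nsgdhess_x gamma0 nsgdhess_stepsize0 /= grad0 enorm0.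
have {D_gt0} D_gt0 : 0 < Delta by rewrite lt_neqAle eq_sym D_gt0.
have u0 : 0 <= 3 * E_init p sigma B by rewrite mulr_ge0// ltW// E_init_gt0.
have avg := run_average p12 L0 F_smooth F_diff2 sigma0 gfP sigma_h0 HfP sampling x0
  (B_init_gt0 p sigma eps) (momentum01 p12 L0 sigma0 sigma_h0 Delta0 eps0)
  (stepsize_gt0 p12 L0 sigma0 sigma_h0 Delta0 eps0 D_gt0) u0
  (batch_moment_E_init eps p12 sigma0) T0 Fs.
apply: (le_trans avg).
by rewrite lee_fin; exact: parameters_bound.
Qed.
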